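(* Let $\alpha>0$ and let $D^{(\alpha)}_{\mathsf{in},n}=\sum_{(\xi,r)\in X^{(n)}}|\xi|^\alpha 1_{B^{\mathbb{T}_n}_{r}(o)}(\xi)$, where $|\xi|={\rm d}_{\mathbb{T}_n}(\xi,o)$. Then: (i) if $s>\alpha+d$, then $\lim_{n\to\infty}\mathbb{E}D^{(\alpha)}_{\mathsf{in},n}=d\kappa_d(\alpha+d)^{-1}\mathbb{E}R^{\alpha+d}$; (ii) if $s=\alpha+d$, then $\lim_{n\to\infty}(\log n)^{-1}\mathbb{E}D^{(\alpha)}_{\mathsf{in},n}=d\kappa_d\beta$; (iii) if $s<\alpha+d$, then $\lim_{n\to\infty}n^{s-\alpha-d}\mathbb{E}D^{(\alpha)}_{\mathsf{in},n}=\beta\int_{[-1/2,1/2]^d}|\eta|^{\alpha-s}\,{\rm d}\eta$. Here $\kappa_d$ is the volume of the unit ball in $\mathbb{R}^d$.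
   Context: Fix an integer $d\ge2$. For $n\ge1$, $\mathbb{T}_n$ is the torus obtained from $[-n/2,n/2]^d$ by identifying opposite faces, with toroidal distance ${\rm d}_{\mathbb{T}_n}$ and $B^{\mathbb{T}_n}_r(\xi)=\{\eta\in\mathbb{T}_n:{\rm d}_{\mathbb{T}_n}(\xi,\eta)\le r\}$. $R$ is a nonnegative random variable with absolutely continuous distribution such that $\lim_{h\to\infty}h^s\mathbb{P}(R>h)=\beta$ for some $\beta,s\in(0,\infty)$. $X^{(n)}$ is a homogeneous Poisson point process of intensity $1$ on $\mathbb{T}_n$, each point independently marked with a mark in $[0,\infty)$ distributed as $R$ (points written $(\xi,r)$). *)

(* Defs.v *)
From HB Require Import structures.
From mathcomp Require Import all_boot all_order all_algebra.
From mathcomp Require Import all_classical all_reals all_analysis.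
Set Implicit Arguments. Unset Strict Implicit. Unset Printing Implicit Defensive.
Import Order.TTheory GRing.Theory Num.Theory.
Import numFieldNormedType.Exports.
Local Open Scope classical_set_scope.
Local Open Scope ring_scope.

Section defs.
Context {R : realType} {d : nat}.

Definition origin : d.-tuple R := [tuple (0 : R) | _ < d].

Definition eucl_norm (x : d.-tuple R) : R := Num.sqrt (\sum_(i < d) tnth x i ^+ 2).

(* the fundamental box [-n/2, n/2)^d, a set of representatives of the torus T_n *)
Definition tbox (n : nat) : set (d.-tuple R) :=
  [set x | forall i, - (n%:R / 2) <= tnth x i < n%:R / 2].

(* distance on the circle R / nZ *)
Definition cdist (n : nat) (a b : R) : R :=
  let L := n%:R in let t := a - b in
  let u := t - L * (Num.floor (t / L))%:~R in Num.min u (L - u).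

Definition tdist (n : nat) (x y : d.-tuple R) : R :=
  Num.sqrt (\sum_(i < d) cdist n (tnth x i) (tnth y i) ^+ 2).

Definition tnorm (n : nat) (x : d.-tuple R) : R := tdist n x origin.

(* lam is the d-dimensional Lebesgue measure (characterised on closed boxes,
   which determines it on the Borel sigma-algebra of R^d) *)
Definition is_lebesgue_d (lam : {measure set (d.-tuple R) -> \bar R}) : Prop :=
  forall a b : d.-tuple R,
    lam [set x | forall i, tnth a i <= tnth x i <= tnth b i] =
    (\prod_(i < d) Num.max (tnth b i - tnth a i) 0)%:E.

Definition kappa (lam : {measure set (d.-tuple R) -> \bar R}) : \bar R :=
  lam [set x | eucl_norm x <= 1].

(* Poisson probability mass function (correct also for rate 0) *)
Definition ppmf (rate : R) (k : nat) : R := rate ^+ k / k`!%:R * expR (- rate).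

(* intensity measure of the marked process on T_n:
   (Lebesgue on the box) (x) (law of the mark) *)
Definition intensity (n : nat) (lam : {measure set (d.-tuple R) -> \bar R})
  (nu : probability R R) (A : set (d.-tuple R * R)) : \bar R :=
  (\int[lam]_(x in tbox n) nu [set r | A (x, r)])%E.

Definition count_in (A : set (d.-tuple R * R)) (cfg : seq (d.-tuple R * R)) : nat :=
  count (fun p => p \in A) cfg.

Definition is_marked_ppp (n : nat) (lam : {measure set (d.-tuple R) -> \bar R})
  (nu : probability R R) {dO} {O : measurableType dO} (P : probability O R)
  (X : O -> seq (d.-tuple R * R)) : Prop :=
  forall (k : nat) (A : 'I_k -> set (d.-tuple R * R)),
    (forall i, measurable (A i)) ->
    (forall i j, i != j -> A i `&` A j = set0) ->
    forall m : 'I_k -> nat,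
      measurable [set w | forall i, count_in (A i) (X w) = m i] /\
      P [set w | forall i, count_in (A i) (X w) = m i] =
      (\prod_(i < k) ppmf (fine (intensity n lam nu (A i))) (m i))%:E.

Definition D_in (alpha : R) (n : nat) (cfg : seq (d.-tuple R * R)) : R :=
  \sum_(p <- cfg) (if tdist n origin p.1 <= p.2 then tnorm n p.1 `^ alpha else 0).

End defs.

(* Main.v *)
Require Import Defs.
From HB Require Import structures.
From mathcomp Require Import all_boot all_order all_algebra.
From mathcomp Require Import all_classical all_reals all_analysis.
From mathcomp Require Import measurable_realfun ring lra.
Import Order.TTheory GRing.Theory Num.Theory.
Import numFieldNormedType.Exports.
Local Open Scope classical_set_scope.
Local Open Scope ring_scope.

(* By Campbell's formula the expected in-degree is the integral of
   |x|^alpha P(R >= |x|) over the box [-n/2, n/2)^d.  Polar coordinates are used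
   in the form: the image of Lebesgue measure on R^d under the norm is kappa_d
   times the image of Lebesgue measure on ]0, +oo[ under t |-> t^(1/d).
   (i) The boxes increase to R^d; then Tonelli, integrating |x|^alpha over the
   ball of radius R first.
   (ii) With t = |x|^d the integrand is asymptotic to beta / t, and the box is
   between the balls of radii n/4 and d n, whose logarithms differ from log n
   by constants.
   (iii) Substituting x = n eta turns the normalised integrand on the unit box
   into |eta|^(alpha - s) (n |eta|)^s P(R >= n |eta|), which converges to
   beta |eta|^(alpha - s) and is dominated by a multiple of it because
   h^s P(R >= h) is bounded. *)

(** * Campbell's formula for random finite lists of points *)

Section campbell.
Context d (T : measurableType d) dO (O : measurableType dO) (R : realType).
Variables (mu : {measure set T -> \bar R}) (P : {measure set O -> \bar R}).
Variable X : O -> seq T.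

Import HBNNSimple.

(** Grouping the points by the value of [g] reduces a simple function to counts of points in its
    level sets, the only quantities about which the hypotheses below speak. *)
Lemma sum_seq_simple (g : {nnsfun T >-> R}) (s : seq T) :
  (\sum_(p <- s) (g p)%:E =
   \sum_(y \in range g) y%:E * (\sum_(p <- s) \1_(g @^-1` [set y]) p)%:E)%E.
Proof.
rewrite sumEFin fsbig_finite//=.
under [RHS]eq_bigr do rewrite -EFinM mulr_sumr.
rewrite sumEFin; congr EFin; rewrite exchange_big/=.
by apply: eq_bigr => p _; rewrite [LHS]fimfunE fsbig_finite.
Qed.

Hypothesis mN : forall A, measurable A ->
  measurable_fun setT (fun w => \sum_(p <- X w) \1_A p : R).
Hypothesis intN : forall A, measurable A ->
  (\int[P]_w (\sum_(p <- X w) \1_A p)%:E = mu A)%E.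

Let sumN_ge0 (g : {nnsfun T >-> R}) y w :
  (0 <= y%:E * (\sum_(p <- X w) \1_(g @^-1` [set y]) p)%:E)%E.
Proof.
have [y0|y0] := leP 0 y.
  by rewrite -EFinM lee_fin mulr_ge0// sumr_ge0.
(* For [y < 0] the level set of the nonnegative [g] is empty, so the negative factor meets a zero
   count. *)
rewrite preimage_nnfun0// big1 ?mule0// => p _.
by rewrite indic0.
Qed.

Let measurable_sum_simple (g : {nnsfun T >-> R}) :
  measurable_fun setT ((fun w => \sum_(p <- X w) (g p)%:E) : O -> \bar R)%E.
Proof.
under eq_fun do rewrite sum_seq_simple.
apply: emeasurable_fsum => // y; apply: measurable_funeM.
by apply/measurable_EFinP; exact: mN.
Qed.

Let integral_sum_simple (g : {nnsfun T >-> R}) :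
  (\int[P]_w \sum_(p <- X w) (g p)%:E = \int[mu]_x (g x)%:E)%E.
Proof.
rewrite integralT_nnsfun sintegralE.
under eq_integral do rewrite sum_seq_simple.
rewrite ge0_integral_fsum//=; last first.
  by move=> y; apply: measurable_funeM; apply/measurable_EFinP; exact: mN.
apply: eq_fsbigr => y _.
have [y0|y0] := leP 0 y.
  rewrite ge0_integralZl//=; first by rewrite intN.
  - by apply/measurable_EFinP; exact: mN.
  - by move=> w _; rewrite lee_fin sumr_ge0.
rewrite preimage_nnfun0// measure0 mule0 integral0_eq// => w _.
by rewrite big1 ?mule0// => p _; rewrite indic0.
Qed.

Variable f : T -> \bar R.
Hypotheses (f0 : forall x, (0 <= f x)%E) (mf : measurable_fun setT f).

Let g := nnsfun_approx measurableT mf.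

Let cvg_g (x : T) : (g n x)%:E @[n --> \oo] --> f x.
Proof. exact/cvg_nnsfun_approx. Qed.

Let nd_g w : nondecreasing_seq (fun n => \sum_(p <- X w) (g n p)%:E)%E.
Proof.
by move=> a b ab; apply: lee_sum => p _; rewrite lee_fin; exact/lefP/nd_nnsfun_approx.
Qed.

Let cvg_sum_g w :
  (\sum_(p <- X w) (g n p)%:E)%E @[n --> \oo] --> (\sum_(p <- X w) f p)%E.
Proof.
elim: (X w) => [|p s ih].
  by rewrite big_nil; under eq_fun do rewrite big_nil; exact: cvg_cst.
rewrite big_cons; under eq_fun do rewrite big_cons.
apply: cvgeD => //.
by apply: ge0_adde_def; rewrite inE// sume_ge0.
Qed.

(** Simple functions follow by linearity from the mean counts; monotone convergence along [g] is
    then applied on both sides, over [P] and over [mu]. *)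
Lemma campbell : (\int[P]_w \sum_(p <- X w) f p = \int[mu]_x f x)%E.
Proof.
transitivity (limn (fun n => \int[P]_w \sum_(p <- X w) (g n p)%:E)%E).
  rewrite -monotone_convergence//.
  - by apply: eq_integral => w _; apply/esym/cvg_lim.
  - by move=> n w _; rewrite sume_ge0// => p _; rewrite lee_fin.
transitivity (limn (fun n => \int[mu]_x (g n x)%:E)%E).
  by congr (limn _); apply/funext => n; exact: integral_sum_simple.
rewrite -monotone_convergence//.
- by apply: eq_integral => x _; apply/cvg_lim.
- by move=> n; exact/measurable_EFinP.
- by move=> n x _; rewrite lee_fin.
- by move=> x _ a b ab; rewrite lee_fin; exact/lefP/nd_nnsfun_approx.
Qed.

End campbell.

(** * Mean and measurability of a Poisson count *)

Section poisson_mean.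
Context {R : realType}.

(** The term [k = 0] vanishes and [k / k! = 1 / (k - 1)!], so a shift of index leaves the
    exponential series. There is no division by [r], so rate 0 is covered. *)
Lemma series_mean_ppmf (r : R) n :
  \sum_(0 <= k < n.+1) k%:R * ppmf r k = r * expR (- r) * series (exp_coeff r) n.
Proof.
rewrite big_nat_recl//= mul0r add0r /series/= mulr_sumr.
apply: eq_bigr => k _; rewrite /ppmf /exp_coeff/= exprS factS natrM invfM.
have k0 : k.+1%:R != 0 :> R by rewrite pnatr_eq0.
have f0 : k`!%:R != 0 :> R by rewrite pnatr_eq0 -lt0n fact_gt0.
by field; rewrite f0 addrC natr1.
Qed.

Lemma cvg_series_mean_ppmf (r : R) :
  \sum_(0 <= k < n) k%:R * ppmf r k @[n --> \oo] --> r.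
Proof.
rewrite -(@cvg_shiftS _ (fun n => \sum_(0 <= k < n) k%:R * ppmf r k)).
under eq_fun do rewrite series_mean_ppmf.
suff : r * expR (- r) * series (exp_coeff r) n @[n --> \oo] -->
    r * expR (- r) * expR r by rewrite -mulrA -expRD addNr expR0 mulr1.
by apply: cvgMr; exact: is_cvg_series_exp_coeff.
Qed.

Context dO (O : measurableType dO) (P : {measure set O -> \bar R}).
Variables (N : O -> nat) (r : R).
Hypothesis mN : forall k, measurable [set w | N w = k].
Hypothesis PN : forall k, P [set w | N w = k] = (ppmf r k)%:E.

(** Only the term [k = N w] is nonzero. In this form the mean and the measurability of [N] both
    follow from the events [N w = k]. *)
Lemma count_series w :
  ((N w)%:R%:E = \sum_(k <oo) (k%:R * \1_[set w | N w = k] w)%:E :> \bar R)%E.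
Proof.
apply/esym/cvg_lim => //; apply: cvg_near_cst.
exists (N w).+1 => // n /= Nn.
rewrite sumEFin big_mkord (bigD1 (Ordinal Nn))//= indicE mem_set// mulr1.
rewrite big1 ?addr0// => i iN; rewrite indicE memNset ?mulr0//= => Ni.
by move: iN; rewrite -val_eqE/= Ni eqxx.
Qed.

Lemma integral_poisson_count : (\int[P]_w (N w)%:R%:E = r%:E)%E.
Proof.
under eq_integral do rewrite count_series.
rewrite integral_nneseries//; last first.
  move=> k; apply/measurable_EFinP; apply: measurable_funM => //.
rewrite (eq_eseriesr (g := fun k => (k%:R * ppmf r k)%:E)); last first.
  move=> k _; under eq_integral do rewrite EFinM.
  rewrite ge0_integralZl//=; last first.
    by apply/measurable_EFinP; exact: measurable_indic.
  by rewrite integral_indic// setIT PN.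
apply/cvg_lim => //=; under eq_fun do rewrite sumEFin.
by apply: cvg_EFin; [exact: nearW|exact: cvg_series_mean_ppmf].
Qed.

Lemma measurable_count : measurable_fun setT (fun w => (N w)%:R : R).
Proof.
apply/measurable_EFinP.
rewrite (_ : _ \o _ = (fun w => \sum_(k <oo) (k%:R * \1_[set w | N w = k] w)%:E)%E).
  apply: ge0_emeasurable_sum => //.
  by move=> k _; apply/measurable_EFinP; exact: measurable_funM.
by apply/funext => w /=; exact: count_series.
Qed.

End poisson_mean.

(** * Measurability of coordinates, norms, distances and boxes *)

Section measurability.
Context {R : realType} {d : nat}.

Lemma measurable_coord (i : 'I_d) :
  measurable_fun setT (fun x : d.-tuple R => tnth x i).
Proof. exact: measurable_tnth. Qed.

Lemma measurable_sqrt : measurable_fun setT (@Num.sqrt R).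
Proof. by apply: nondecreasing_measurable => // x y; exact: ler_wsqrtr. Qed.

Lemma measurable_cdist n (f g : d.-tuple R -> R) :
  measurable_fun setT f -> measurable_fun setT g ->
  measurable_fun setT (fun x => cdist n (f x) (g x)).
Proof.
move=> mf mg; rewrite /cdist.
have mt : measurable_fun setT (fun x => f x - g x) by exact: measurable_funB.
have mu : measurable_fun setT (fun x =>
    f x - g x - n%:R * (Num.floor ((f x - g x) / n%:R))%:~R).
  apply: measurable_funB => //; apply: measurable_funM => //.
  apply: (@measurableT_comp _ _ _ _ _ _ (fun t : R => (Num.floor t)%:~R : R)).
    apply: nondecreasing_measurable => // x y xy.
    by rewrite ler_int; exact: le_floor.
  exact: measurable_funM.
by apply: measurable_minr => //; exact: measurable_funB.
Qed.

Lemma measurable_sqrt_sum (F : 'I_d -> d.-tuple R -> R) :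
  (forall i, measurable_fun setT (F i)) ->
  measurable_fun setT (fun x => Num.sqrt (\sum_(i < d) F i x ^+ 2)).
Proof.
move=> mF; apply: measurableT_comp; first exact: measurable_sqrt.
by apply: measurable_sum => i; exact: measurable_funX.
Qed.

Lemma measurable_eucl_norm : measurable_fun setT (@eucl_norm R d).
Proof. by apply: measurable_sqrt_sum => i; exact: measurable_coord. Qed.

Lemma measurable_tdist_origin n : measurable_fun setT (tdist n (@origin R d)).
Proof.
apply: measurable_sqrt_sum => i.
by apply: measurable_cdist => //; exact: measurable_coord.
Qed.

Lemma measurable_tnorm n : measurable_fun setT (@tnorm R d n).
Proof.
apply: measurable_sqrt_sum => i.
by apply: measurable_cdist => //; exact: measurable_coord.
Qed.

Lemma measurable_all_coord (A : 'I_d -> set R) : (forall i, measurable (A i)) ->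
  measurable [set x : d.-tuple R | forall i, A i (tnth x i)].
Proof.
move=> mA.
rewrite (_ : mkset _ = \bigcap_(i in [set: 'I_d])
    ((fun x : d.-tuple R => tnth x i) @^-1` A i)).
  apply: fin_bigcap_measurable => [|i _]; first exact: finite_finset.
  by rewrite -[X in measurable X]setTI; exact: measurable_coord.
by apply/seteqP; split=> [x xA i _|x xA i]; exact: xA.
Qed.

(** The closed boxes on which [is_lebesgue_d] prescribes the measure. *)
Definition cbox (a b : d.-tuple R) : set (d.-tuple R) :=
  [set x | forall i, tnth a i <= tnth x i <= tnth b i].

Lemma measurable_cbox a b : measurable (cbox a b).
Proof.
have := @measurable_all_coord (fun i => `[tnth a i, tnth b i]%classic).
rewrite (_ : mkset _ = cbox a b); first by apply => i.
by apply/seteqP; split => x /= + i => /(_ i); rewrite in_itv.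
Qed.

Lemma measurable_tbox n : measurable (@tbox R d n).
Proof.
have := @measurable_all_coord (fun=> `[- (n%:R / 2), n%:R / 2[%classic).
rewrite (_ : mkset _ = @tbox R d n); first by apply => i.
by apply/seteqP; split => x /= + i => /(_ i); rewrite in_itv.
Qed.

End measurability.

(** * The torus distance to the origin is Euclidean on the box *)

Section torus_distance.
Context {R : realType} {d : nat}.

(* The upper end point [n / 2], outside [tbox n], is needed because
   [tdist n origin x] involves [- x]. *)
Lemma cdist0 n (t : R) : (0 < n)%N -> - (n%:R / 2) <= t <= n%:R / 2 ->
  cdist n t 0 = `|t|.
Proof.
move=> n0 /andP[t1 t2]; have L0 : 0 < n%:R :> R by rewrite ltr0n.
rewrite /cdist subr0; have [t0|t0] := leP 0 t.
  rewrite (_ : Num.floor _ = 0) ?mulr0 ?subr0.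
    by rewrite ger0_norm// min_l//; lra.
  apply/eqP; rewrite floor_eq/= divr_ge0//= ltr_pdivrMr//; lra.
(* For [t < 0] the reduction modulo [n] gives [u = t + n], and the minimum is attained by
   [n - u = - t]. *)
rewrite (_ : Num.floor _ = -1); last first.
  apply/eqP; rewrite floor_eq/= ler_pdivlMr// ltr_pdivrMr//; lra.
by rewrite ltr0_norm// mulrN1 min_r; lra.
Qed.

Lemma tnorm_eucl n (x : d.-tuple R) : (0 < n)%N -> tbox n x -> tnorm n x = eucl_norm x.
Proof.
move=> n0 xn; rewrite /tnorm /tdist /eucl_norm; congr (Num.sqrt _).
apply: eq_bigr => i _; rewrite [tnth origin i]tnth_mktuple cdist0 ?real_normK ?num_real//.
by have /andP[-> /ltW ->] := xn i.
Qed.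

Lemma tdist_origin_eucl n (x : d.-tuple R) : (0 < n)%N -> tbox n x ->
  tdist n origin x = eucl_norm x.
Proof.
move=> n0 xn; rewrite /tdist /eucl_norm; congr (Num.sqrt _).
apply: eq_bigr => i _; rewrite [tnth origin i]tnth_mktuple.
rewrite (_ : cdist _ _ _ = cdist n (- tnth x i) 0); last first.
  by rewrite /cdist sub0r subr0.
rewrite cdist0 ?normrN ?real_normK ?num_real//.
by have /andP[x1 /ltW x2] := xn i; apply/andP; split; lra.
Qed.

End torus_distance.

(** * Expected in-degree as an integral over the box *)

Lemma ge0_integral_mrestr d (T : measurableType d) (R : realType)
    (mu : {measure set T -> \bar R}) (D : set T) (mD : measurable D)
    (f : T -> \bar R) : measurable_fun setT f -> (forall x, (0 <= f x)%E) ->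
  (\int[mrestr mu mD]_x f x = \int[mu]_(x in D) f x)%E.
Proof.
move=> mf f0.
(* The complement of [D] is null for the restricted measure, and on subsets of [D] both measures
   agree. *)
rewrite (@ge0_negligible_integral _ _ _ _ setT (~` D))//; last 2 first.
- exact: measurableC.
- by rewrite /= /mrestr setICl measure0.
rewrite setTD setCK; apply: eq_measure_integral => A mA AD.
by rewrite /= /mrestr setIidl.
Qed.

Lemma count_in_indic {R : realType} {d : nat} (A : set (d.-tuple R * R))
    (s : seq (d.-tuple R * R)) :
  (count_in A s)%:R = \sum_(p <- s) \1_A p :> R.
Proof.
rewrite /count_in -sum1_count natr_sum big_mkcond; apply: eq_bigr => p _; rewrite indicE; by case: ifP.
Qed.

Section expected_indegree.
Context {R : realType} {d : nat}.
Variables (lam : {measure set (d.-tuple R) -> \bar R}) (hlam : is_lebesgue_d lam).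

Lemma lebesgue_d_tbox_lty n : (lam (tbox n) < +oo)%E.
Proof.
pose a : d.-tuple R := [tuple - (n%:R / 2) | _ < d].
pose b : d.-tuple R := [tuple n%:R / 2 | _ < d].
apply: (@le_lt_trans _ _ (lam (cbox a b))); last by rewrite hlam ltry.
apply: le_measure; rewrite ?inE.
- exact: measurable_tbox.
- exact: measurable_cbox.
- by move=> x xn i; rewrite !tnth_mktuple; have /andP[-> /ltW ->] := xn i.
Qed.

Variables (nu : probability R R) (n : nat) (n0 : (0 < n)%N).
Context {dO} {O : measurableType dO} (P : probability O R).
Variables (X : O -> seq (d.-tuple R * R)) (hX : is_marked_ppp n lam nu P X).

(** Restricted to the box, [lam] becomes a finite measure, so that Tonelli's theorem applies to its
    product with [nu]. *)
Let lamn : {finite_measure set (d.-tuple R) -> \bar R} :=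
  mfrestr (measurable_tbox n) (lebesgue_d_tbox_lty n).

Lemma intensityE (A : set (d.-tuple R * R)) : measurable A ->
  intensity n lam nu A = (lamn \x nu)%E A.
Proof.
move=> mA; rewrite /intensity /product_measure1/=.
rewrite ge0_integral_mrestr//=; last exact: measurable_fun_xsection.
apply: eq_integral => x _; congr (nu _).
by apply/seteqP; split => r /=; rewrite /xsection/= inE.
Qed.

(** The Poisson rate in [is_marked_ppp] is read through [fine], which would send an infinite
    intensity to 0. *)
Lemma intensity_fin_num (A : set (d.-tuple R * R)) : measurable A ->
  intensity n lam nu A \is a fin_num.
Proof.
move=> mA; rewrite intensityE// ge0_fin_numE//.
apply: (@le_lt_trans _ _ ((lamn \x nu) (setT `*` setT))%E).
  by apply: le_measure; rewrite ?inE//; exact: measurableX.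
rewrite product_measure1E// -ge0_fin_numE ?mule_ge0//.
by rewrite fin_numM//; exact: fin_num_measure.
Qed.

(** The defining property of the process for the family consisting of [A] alone. *)
Lemma count_in_law (A : set (d.-tuple R * R)) k : measurable A ->
  measurable [set w | count_in A (X w) = k] /\
  P [set w | count_in A (X w) = k] =
    (ppmf (fine (intensity n lam nu A)) k)%:E.
Proof.
move=> mA.
have [|i j ij|] := @hX 1 (fun=> A) _ _ (fun=> k); first by [].
  by rewrite !ord1 eqxx in ij.
rewrite (_ : mkset _ = [set w | count_in A (X w) = k]).
  by rewrite big_ord1.
by apply/seteqP; split=> w /= h => [|i]; [exact: (h ord0)|exact: h].
Qed.

Lemma expected_sum_points (f : d.-tuple R * R -> \bar R) :
  (forall p, 0 <= f p)%E -> measurable_fun setT f ->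
  (\int[P]_w (\sum_(p <- X w) f p) =
   \int[lam]_(x in tbox n) \int[nu]_r f (x, r))%E.
Proof.
move=> f0 mf.
rewrite (@campbell _ _ _ _ _ (lamn \x nu)%E)//.
- rewrite fubini_tonelli1// ge0_integral_mrestr//.
    exact: measurable_fun_fubini_tonelli_F.
  by move=> x; exact: integral_ge0.
- move=> A mA; under eq_fun do rewrite -count_in_indic.
  apply: (@measurable_count _ _ _ (fun w => count_in A (X w))) => k.
  by have [] := count_in_law A k mA.
- move=> A mA; under eq_integral do rewrite -count_in_indic.
  rewrite (@integral_poisson_count _ _ _ _ _ (fine (intensity n lam nu A))).
  + by rewrite fineK ?intensity_fin_num// intensityE.
  + by move=> k; have [] := count_in_law A k mA.
  + by move=> k; have [] := count_in_law A k mA.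
Qed.

(** Campbell's formula and Tonelli leave, for each [x], the integral over the mark of the indicator
    of [|x| <= r]. *)
Lemma expected_D_in alpha :
  (\int[P]_w (D_in alpha n (X w))%:E =
   \int[lam]_(x in tbox n) ((eucl_norm x `^ alpha)%:E *
                             nu [set r | (eucl_norm x <= r)%R]))%E.
Proof.
under eq_integral do rewrite /D_in -sumEFin.
rewrite (expected_sum_points (fun p => (if (tdist n origin p.1 <= p.2)%R
   then tnorm n p.1 `^ alpha else 0)%:E)).
- apply: eq_integral => x /[!inE] xn.
  rewrite /= tdist_origin_eucl// tnorm_eucl//.
  have mB : measurable [set r : R | eucl_norm x <= r].
    rewrite (_ : mkset _ = `[eucl_norm x, +oo[%classic)//.
    by apply/seteqP; split => r /=; rewrite in_itv/= andbT.
  under eq_integral => r _.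
    rewrite (_ : (if _ then _ else _)%:E = (eucl_norm x `^ alpha)%:E *
        (\1_[set r | (eucl_norm x <= r)%R] r)%:E)%E; last first.
      rewrite -EFinM indicE; case: ifPn => xr; first by rewrite mem_set ?mulr1.
      by rewrite memNset ?mulr0//=; exact/negP.
    over.
  rewrite ge0_integralZl//=; last 2 first.
  - by apply/measurable_EFinP; exact: measurable_indic.
  - by rewrite lee_fin powR_ge0.
  by rewrite integral_indic// setIT.
- by move=> p; rewrite lee_fin; case: ifPn => // _; exact: powR_ge0.
- apply/measurable_EFinP; apply: measurable_fun_ifT => //.
  + apply: measurable_fun_ler => //.
    exact: measurableT_comp (measurable_tdist_origin n) measurable_fst.
  + apply: (measurableT_comp (measurable_powR _)) => //.
    exact: measurableT_comp (measurable_tnorm n) measurable_fst.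
Qed.

End expected_indegree.

(** * Closed boxes determine a measure on [R^d] *)

Section uniqueness.
Context {R : realType} {d : nat}.

Let G : set (set (d.-tuple R)) := [set A | exists a b, A = cbox a b].

Let cube (k : nat) : set (d.-tuple R) := cbox [tuple - k%:R | _ < d] [tuple k%:R | _ < d].

Lemma exists_nat_ge_norm (x : d.-tuple R) :
  exists k : nat, forall i, `|tnth x i| <= k%:R.
Proof.
exists (\max_(i < d) (Num.truncn `|tnth x i|).+1)%N => i.
apply: (le_trans (ltW (truncnS_gt _))).
by rewrite ler_nat (@leq_bigmax _ (fun i => (Num.truncn `|tnth x i|).+1) i).
Qed.

Let cover_cube : \bigcup_k (cube k) = setT.
Proof.
apply/seteqP; split => // x _.
have [k xk] := exists_nat_ge_norm x; exists k => // i.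
by rewrite !tnth_mktuple -ler_norml.
Qed.

Let setIG : setI_closed G.
Proof.
move=> _ _ [a [b ->]] [a' [b' ->]].
exists [tuple Num.max (tnth a i) (tnth a' i) | i < d].
exists [tuple Num.min (tnth b i) (tnth b' i) | i < d].
apply/seteqP; split => [x [xab xab'] i|x xI].
  rewrite !tnth_mktuple ge_max le_min.
  by have /andP[-> ->] := xab i; have /andP[-> ->] := xab' i.
by split => i; have := xI i; rewrite !tnth_mktuple ge_max le_min;
  move=> /andP[/andP[h1 h2] /andP[h3 h4]]; apply/andP.
Qed.

(** The half-space where coordinate [i] is at least [c] is a countable union of closed boxes: bounds
    [c] and [k] in that coordinate, [- k] and [k] in the others. *)
Let measurable_tnth_G (i : 'I_d) :
  measurable_fun (setT : set (g_sigma_algebraType G)) (fun x : d.-tuple R => tnth x i).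
Proof.
apply: (measurability (@RGenCInfty.G R)) => [|/= _ [_ [c ->] <-]].
  exact: RGenCInfty.measurableE.
rewrite setTI.
rewrite (_ : _ @^-1` _ = \bigcup_k cbox [tuple if j == i then c else - k%:R | j < d]
   [tuple k%:R | _ < d]).
  apply: bigcupT_measurable => k; apply: sub_sigma_algebra.
  by eexists; eexists.
apply/seteqP; split => [x /=|x [k _ /(_ i)]].
  rewrite in_itv/= andbT => cx; have [k xk] := exists_nat_ge_norm x; exists k => // j.
  have := xk j; rewrite ler_norml => /andP[x1 x2].
  by rewrite !tnth_mktuple x2 andbT; case: eqP => [->|].
by rewrite !tnth_mktuple eqxx /= in_itv/= andbT => /andP[].
Qed.

Let measurable_tupleE : (measurable : set (set (d.-tuple R))) = <<s G>>.
Proof.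
apply/seteqP; split; last first.
  apply: smallest_sub; first exact: sigma_algebra_measurable.
  by move=> _ [a [b ->]]; exact: measurable_cbox.
apply: smallest_sub; first exact: smallest_sigma_algebra.
move=> A; rewrite -bigcup_seq => -[i _ [B mB <-]].
exact: measurable_tnth_G.
Qed.

(** Closed boxes are stable under intersection, generate the sigma-algebra, and the cubes among them
    exhaust the space. *)
Lemma measure_unique_cbox (m1 m2 : {measure set (d.-tuple R) -> \bar R}) :
  (forall a b, m1 (cbox a b) = m2 (cbox a b)) ->
  (forall a b, m1 (cbox a b) < +oo)%E ->
  forall A, measurable A -> m1 A = m2 A.
Proof.
move=> m12 m1y; apply: (measure_unique G cube) => //.
- by move=> k; eexists; eexists.
- by move=> _ [a [b ->]].
- by move=> k; exact: m1y.
Qed.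

End uniqueness.

(** * Image measures *)

Section image_measure.
Context d1 d2 (T1 : measurableType d1) (T2 : measurableType d2) (R : realType).
Variables (m : {measure set T1 -> \bar R}) (f : T1 -> T2).

(* [pushforward m f] only has a measure structure up to a proof that [f] is
   measurable, which inference cannot recover; here it is a parameter. *)
Definition image_measure (mf : measurable_fun setT f) := pushforward m f.

Variable mf : measurable_fun setT f.

Let image_measure0 : image_measure mf set0 = 0.
Proof. exact: measure0. Qed.

Let image_measure_ge0 A : (0 <= image_measure mf A)%E.
Proof. exact: measure_ge0. Qed.

Let image_measure_sigma_additive : semi_sigma_additive (image_measure mf).
Proof. exact: measure_semi_sigma_additive. Qed.

HB.instance Definition _ := isMeasure.Build _ _ _ (image_measure mf)
  image_measure0 image_measure_ge0 image_measure_sigma_additive.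

End image_measure.
Arguments image_measure {d1 d2 T1 T2 R} m {f} mf.

(** * Scaling of Lebesgue measure and the volume of balls *)

Section scaling.
Context {R : realType} {d : nat}.

Definition scale_tuple (r : R) (x : d.-tuple R) : d.-tuple R :=
  [tuple r * tnth x i | i < d].

Lemma measurable_scale_tuple r : measurable_fun setT (scale_tuple r).
Proof.
apply/measurable_fun_tnthP => i.
rewrite (_ : _ \o _ = fun x => r * tnth x i); last first.
  by apply/funext => x /=; rewrite tnth_mktuple.
by apply: measurable_funM => //; exact: measurable_coord.
Qed.

Lemma eucl_norm_ge0 (x : d.-tuple R) : 0 <= eucl_norm x.
Proof. exact: sqrtr_ge0. Qed.

Lemma eucl_norm_scale r (x : d.-tuple R) : 0 <= r ->
  eucl_norm (scale_tuple r x) = r * eucl_norm x.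
Proof.
move=> r0; rewrite /eucl_norm.
under eq_bigr do rewrite tnth_mktuple exprMn.
by rewrite -mulr_sumr sqrtrM ?sqr_ge0// sqrtr_sqr ger0_norm.
Qed.

Variables (lam : {measure set (d.-tuple R) -> \bar R}) (hlam : is_lebesgue_d lam).

(** Both sides are measures in [A]; they agree on closed boxes, where each side length contributes
    one factor [r]. *)
Lemma lebesgue_d_scale r (A : set (d.-tuple R)) : 0 < r -> measurable A ->
  ((r ^+ d)%:E * lam (scale_tuple r @^-1` A) = lam A)%E.
Proof.
move=> r0 mA; have rd0 : 0 <= r ^+ d by rewrite exprn_ge0// ltW.
have key a b : mscale (NngNum rd0) (image_measure lam (measurable_scale_tuple r)) (cbox a b) =
    lam (cbox a b).
  rewrite /mscale/= /image_measure /pushforward hlam.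
  rewrite (_ : _ @^-1` _ = cbox (scale_tuple r^-1 a) (scale_tuple r^-1 b)).
    rewrite hlam -EFinM; congr EFin.
    rewrite -[in r ^+ d](card_ord d) -prodr_const -big_split/=.
    apply: eq_bigr => i _; rewrite !tnth_mktuple maxr_pMr ?ltW// mulr0.
    by rewrite -mulrBr mulrA divff ?gt_eqF// mul1r.
  apply/seteqP; split => x /= + i => /(_ i);
    by rewrite !tnth_mktuple ler_pdivrMl// ler_pdivlMl.
apply: (@measure_unique_cbox _ _
  (mscale (NngNum rd0) (image_measure lam (measurable_scale_tuple r))) lam) => // a b.
have lt : (lam (cbox a b) < +oo)%E by rewrite hlam ltry.
by move: lt; rewrite -(key a b).
Qed.

Lemma ge0_integral_scale r (D : set (d.-tuple R)) (f : d.-tuple R -> \bar R) :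
  0 < r -> measurable D -> measurable_fun setT f -> (forall x, 0 <= f x)%E ->
  (\int[lam]_(x in D) f x =
   (r ^+ d)%:E * \int[lam]_(x in scale_tuple r @^-1` D) f (scale_tuple r x))%E.
Proof.
move=> r0 mD mf f0; have rd0 : 0 <= r ^+ d by rewrite exprn_ge0// ltW.
transitivity (\int[mscale (NngNum rd0) (image_measure lam (measurable_scale_tuple r))]_(x in D) f x)%E.
  by apply: eq_measure_integral => A mA _; apply/esym; exact: lebesgue_d_scale.
rewrite ge0_integral_mscale//; last exact: measurable_funTS.
rewrite ge0_integral_pushforward//.
  exact: measurable_scale_tuple.
exact: measurable_funTS.
Qed.

Lemma measurable_ball_eucl (r : R) : measurable [set x : d.-tuple R | eucl_norm x <= r].
Proof.
rewrite (_ : mkset _ = eucl_norm @^-1` `]-oo, r]).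
  by rewrite -[X in measurable X]setTI; exact: measurable_eucl_norm.
by apply/seteqP; split => x /=; rewrite in_itv.
Qed.

(** The unit ball lies in the cube [[-1, 1]^d]. *)
Lemma kappa_lty : (kappa lam < +oo)%E.
Proof.
pose a : d.-tuple R := [tuple -1 | _ < d].
pose b : d.-tuple R := [tuple 1 | _ < d].
apply: (@le_lt_trans _ _ (lam (cbox a b))); last by rewrite hlam ltry.
apply: le_measure; rewrite ?inE; [exact: measurable_ball_eucl|exact: measurable_cbox|].
move=> x /= x1 i; rewrite !tnth_mktuple -ler_norml -sqrtr_sqr.
apply: le_trans x1; apply: ler_wsqrtr.
by rewrite (bigD1 i)//= lerDl sumr_ge0// => j _; exact: sqr_ge0.
Qed.

Lemma kappaE : kappa lam = (fine (kappa lam))%:E.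
Proof. by rewrite fineK// ge0_fin_numE// kappa_lty. Qed.

Lemma eucl_norm_eq0 (x : d.-tuple R) : (eucl_norm x <= 0) = (x == origin).
Proof.
apply/idP/eqP => [|->].
  rewrite /eucl_norm le_eqVlt ltNge sqrtr_ge0 orbF sqrtr_eq0 => h.
  apply: eq_from_tnth => i; rewrite [RHS]tnth_mktuple; apply/eqP.
  rewrite -sqrf_eq0 eq_le sqr_ge0 andbT; apply: le_trans h.
  by rewrite (bigD1 i)//= lerDl sumr_ge0// => j _; exact: sqr_ge0.
rewrite /eucl_norm big1 ?sqrtr0// => i _.
by rewrite [tnth origin i]tnth_mktuple expr0n.
Qed.

Lemma lebesgue_d_origin : (0 < d)%N -> lam [set origin] = 0.
Proof.
move=> d0; rewrite (_ : [set _] = cbox origin origin).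
  by rewrite hlam (bigD1 (Ordinal d0))//= subrr maxxx mul0r.
apply/seteqP; split => [_ -> i /=|x /= xo]; first by rewrite !lexx.
by apply: eq_from_tnth => i; apply/eqP; rewrite eq_le andbC; exact: xo.
Qed.

Lemma lebesgue_d_ball (r : R) : (0 < d)%N -> 0 <= r ->
  lam [set x | eucl_norm x <= r] = ((r ^+ d)%:E * kappa lam)%E.
Proof.
move=> d0; rewrite le_eqVlt => /predU1P[<-|r0].
  (* Scaling needs [0 < r]; for [r = 0] the ball is the origin, a null set since [0 < d]. *)
  rewrite expr0n gtn_eqF// mul0e -(lebesgue_d_origin d0); congr (lam _).
  by apply/seteqP; split => x /=; rewrite eucl_norm_eq0 => /eqP.
rewrite -(lebesgue_d_scale r)//; last exact: measurable_ball_eucl.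
congr (_ * lam _)%E.
suff E x : (eucl_norm (scale_tuple r x) <= r) = (eucl_norm x <= 1).
  by apply/seteqP; split => x /=; rewrite E.
by rewrite eucl_norm_scale ?(ltW r0)// -[leRHS]mulr1 ler_pM2l.
Qed.

End scaling.

(** * Rays determine a measure on the line *)

Section uniqueness_ray.
Context {R : realType}.

Let G : set (set R) := [set A | exists x : R, A = `]-oo, x]%classic].

Let measurable_GE : (measurable : set (set R)) = <<s G>>.
Proof.
apply/seteqP; split; last first.
  apply: smallest_sub; first exact: sigma_algebra_measurable.
  by move=> _ [x ->].
rewrite [X in X `<=` _]RGenOInfty.measurableE.
apply: smallest_sub; first exact: smallest_sigma_algebra.
move=> _ [x ->]; rewrite -setCitvl.
apply: sigma_algebraC; apply: sub_sigma_algebra; by exists x.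
Qed.

Lemma measure_unique_ray (m1 m2 : {measure set R -> \bar R}) :
  (forall x : R, m1 `]-oo, x]%classic = m2 `]-oo, x]%classic) ->
  (forall x : R, m1 `]-oo, x]%classic < +oo)%E ->
  forall A, measurable A -> m1 A = m2 A.
Proof.
move=> m12 m1y; apply: (measure_unique G (fun k => `]-oo, k%:R]%classic)).
- exact: measurable_GE.
- move=> _ _ [x ->] [y ->]; exists (Num.min x y).
  by apply/seteqP; split => z /=; rewrite !in_itv/= le_min => /andP.
- by move=> k; exists k%:R.
- apply/seteqP; split => // x _; exists (Num.truncn `|x|).+1 => //=.
  by rewrite in_itv/=; apply: (le_trans (ler_norm _)); exact/ltW/truncnS_gt.
- by move=> _ [x ->].
- by move=> k; exact: m1y.
Qed.

End uniqueness_ray.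

(** * Polar coordinates for radial functions *)

Section radial.
Context {R : realType} {d : nat}.
Variables (lam : {measure set (d.-tuple R) -> \bar R}) (hlam : is_lebesgue_d lam).
Hypothesis d0 : (0 < d)%N.

Local Notation mu := (@lebesgue_measure R).
Local Notation pos := (`]0%R, +oo[%classic : set R).

Let root (t : R) : R := t `^ d%:R^-1.

Let measurable_root : measurable_fun setT root.
Proof. exact: measurable_powR. Qed.

Let dR0 : d%:R != 0 :> R. Proof. by rewrite pnatr_eq0 -lt0n. Qed.

Let root_le (t x : R) : 0 <= t -> 0 <= x -> (root t <= x) = (t <= x ^+ d).
Proof.
move=> t0 x0.
have tE : root t ^+ d = t.
  by rewrite -powR_mulrn ?powR_ge0// -powRrM mulVf// powRr1.
by rewrite -[in RHS]tE ler_pXn2r// nnegrE powR_ge0.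
Qed.

Let kap0 : 0 <= fine (kappa lam). Proof. exact: fine_ge0. Qed.

Let mrestr_pos : {measure set (measurableTypeR R) -> \bar R} :=
  mrestr mu (measurable_itv `]0%R, +oo[).

Let radial_measure : {measure set R -> \bar R} :=
  mscale (NngNum kap0) (image_measure mrestr_pos measurable_root).

Let norm_measure : {measure set R -> \bar R} := image_measure lam measurable_eucl_norm.

(** For [0 <= x] both sides are [kappa lam] times [x ^ d]: the volume of a ball on the left, the
    length of []0, x ^ d]] on the right. For [x < 0] both vanish. *)
Let radial_ray (x : R) : norm_measure `]-oo, x]%classic = radial_measure `]-oo, x]%classic.
Proof.
rewrite /norm_measure/= /image_measure /pushforward /radial_measure/=.
rewrite /mscale/= /mrestr.
have [x0|x0] := leP 0 x.
  rewrite (_ : _ @^-1` _ = [set y | eucl_norm y <= x]); last first.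
    by apply/seteqP; split => y /=; rewrite in_itv.
  rewrite lebesgue_d_ball// muleC kappaE//; congr (_ * _)%E.
  rewrite (_ : _ `&` _ = `]0, x ^+ d]%classic); last first.
    apply/seteqP; split => t /=; rewrite !in_itv/= ?andbT.
      by move=> [h t0]; rewrite t0 -root_le// ltW.
    by move=> /andP[t0 h]; split => //; rewrite root_le// ltW.
  rewrite lebesgue_measure_itv/= lte_fin; have := exprn_ge0 d x0.
  by rewrite le_eqVlt => /predU1P[<-|->]; rewrite ?ltxx ?sube0.
rewrite (_ : _ @^-1` _ = set0); last first.
  apply/seteqP; split => y //=; rewrite in_itv/= => yx.
  by have := le_lt_trans yx x0; rewrite ltNge eucl_norm_ge0.
rewrite [X in mu X](_ : _ = set0) ?measure0 ?mule0//.
apply/seteqP; split => t //=; rewrite !in_itv/= => -[tx _].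
by have := le_lt_trans tx x0; rewrite ltNge powR_ge0.
Qed.

(** With [t = |x|^d] in place of [|x|] as variable, the radial density is the constant [kappa lam];
    the two measures on the line are identified through rays. *)
Lemma ge0_integral_radial (h : R -> \bar R) :
  measurable_fun setT h -> (forall t, 0 <= h t)%E ->
  (\int[lam]_x h (eucl_norm x) =
   kappa lam * \int[mu]_(t in pos) h (t `^ d%:R^-1)%R)%E.
Proof.
move=> mh h0.
transitivity (\int[norm_measure]_t h t)%E.
  rewrite [RHS]ge0_integral_pushforward ?preimage_setT//.
  exact: measurable_eucl_norm.
transitivity (\int[radial_measure]_t h t)%E.
  apply: eq_measure_integral => A mA _; apply: measure_unique_ray => // x.
  rewrite /norm_measure/= /image_measure /pushforward.
  apply: (@le_lt_trans _ _ (lam [set y | eucl_norm y <= `|x|])).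
    apply: le_measure; rewrite ?inE.
    - by rewrite -[X in measurable X]setTI; exact: measurable_eucl_norm.
    - exact: measurable_ball_eucl.
    - by move=> y /=; rewrite in_itv/= => /le_trans; apply; exact: ler_norm.
  by rewrite lebesgue_d_ball// kappaE// -EFinM ltry.
rewrite ge0_integral_mscale//= kappaE//; congr (_ * _)%E.
rewrite [LHS]ge0_integral_pushforward//=.
rewrite ge0_integral_mrestr//.
exact: measurableT_comp.
Qed.

End radial.

(** * Integrals of powers on intervals *)

Section power_integrals.
Context {R : realType}.
Local Notation mu := (@lebesgue_measure R).

Lemma derivable_oo_LRcontinuous_gt0 (F f : R -> R) (a b : R) : 0 < a -> a < b ->
  (forall x : R, 0 < x -> is_derive x 1 F (f x)) ->
  derivable_oo_LRcontinuous F a b.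
Proof.
move=> a0 ab dF.
have cF (x : R) : 0 < x -> F @ x --> F x.
  move=> x0; apply: differentiable_continuous; apply/derivable1_diffP.
  by have [] := dF _ x0.
split.
- move=> x; rewrite in_itv/= => /andP[ax _].
  by have [] := dF _ (lt_trans a0 ax).
- by apply: cvg_at_right_filter; exact: cF.
- by apply: cvg_at_left_filter; apply: cF; exact: lt_trans ab.
Qed.

Lemma integral_is_derive_gt0 (F f : R -> R) (a b : R) : 0 < a -> a < b ->
  (forall x : R, 0 < x -> is_derive x 1 F (f x)) ->
  (forall x : R, 0 < x -> {for x, continuous f}) ->
  (\int[mu]_(x in `[a, b]) (f x)%:E = (F b)%:E - (F a)%:E)%E.
Proof.
move=> a0 ab dF cf; apply: continuous_FTC2 => //.
- apply: continuous_in_subspaceT => x; rewrite inE/= in_itv/= => /andP[ax _].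
  by apply: cf; exact: lt_le_trans ax.
- exact: derivable_oo_LRcontinuous_gt0 dF.
- move=> x; rewrite in_itv/= => /andP[ax _].
  have [_ <-] := dF _ (lt_trans a0 ax); exact: derive1E.
Qed.

Lemma continuous_powR_gt0 (q x : R) : 0 < x -> {for x, continuous (@powR R ^~ q)}.
Proof.
move=> x0; apply: differentiable_continuous; apply/derivable1_diffP.
by apply: derivable_powR; rewrite in_itv/= x0.
Qed.

(* [x `^ (-1)] rather than [x^-1]: measurability is available for [powR]. *)
Lemma integral_powRN1 (a b : R) : 0 < a -> a < b ->
  (\int[mu]_(x in `[a, b]) (x `^ (-1))%:E = (ln b - ln a)%:E)%E.
Proof.
move=> a0 ab; rewrite EFinB.
apply: (integral_is_derive_gt0 (@ln R) (@powR R ^~ (-1))) => // x x0.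
  by rewrite powR_inv1 ?ltW//; exact: is_derive1_ln.
exact: continuous_powR_gt0.
Qed.

Lemma integral_powR_itvcc (q a b : R) : -1 < q -> 0 < a -> a < b ->
  (\int[mu]_(x in `[a, b]) (x `^ q)%:E =
   ((b `^ (q + 1) - a `^ (q + 1)) / (q + 1))%:E)%E.
Proof.
move=> q1 a0 ab; have q0 : q + 1 != 0 by rewrite gt_eqF//; lra.
pose F x := (q + 1)^-1 * x `^ (q + 1).
have dF (x : R) : 0 < x -> is_derive x 1 F (x `^ q).
  move=> x0; have := is_deriveZ (q + 1)^-1 (is_derive1_powR (q + 1) x0).
  by rewrite /= addrK scalerA mulVf// scale1r.
rewrite (integral_is_derive_gt0 F (fun x => x `^ q) a b a0 ab dF)//.
  by rewrite -EFinB /F -mulrBr mulrC.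
by move=> x; exact: continuous_powR_gt0.
Qed.

(** The integrand may blow up at 0, so the primitive is used on [[a k, b]] and [a k] is sent to 0;
    [-1 < q] makes the lower boundary term vanish in the limit. *)
Lemma integral_powR_itv0c (q b : R) : -1 < q -> 0 <= b ->
  (\int[mu]_(x in `]0%R, b]) (x `^ q)%:E = (b `^ (q + 1) / (q + 1))%:E)%E.
Proof.
move=> q1; have q0 : 0 < q + 1 by lra.
rewrite le_eqVlt => /predU1P[<-|b0].
  by rewrite set_itvoc0 integral_set0 powR0 ?gt_eqF// mul0r.
(* The denominators start at 2, so that [a k < b] already for [k = 0]. *)
pose a k : R := b / k.+2%:R.
have a0 k : 0 < a k by rewrite divr_gt0.
have ab k : a k < b by rewrite ltr_pdivrMr// ltr_pMr// ltr1n.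
have cvga : a k @[k --> \oo] --> (0 : R).
  rewrite -(mulr0 b); apply: cvgMr.
  by have := @cvg_harmonic R; rewrite -cvg_shiftS.
have cvga' : a k `^ (q + 1) @[k --> \oo] --> (0 : R).
  by have /cvg_at_rightP := powR_cvg0 q0; apply.
have <- : \bigcup_k `[a k, b]%classic = `]0%R, b]%classic.
  apply/seteqP; split => [x [k _]|x] /=; rewrite !in_itv/=.
    by move=> /andP[ax ->]; rewrite (lt_le_trans _ ax).
  move=> /andP[x0 xb].
  have [N _ /(_ _ (leqnn N)) aN] := cvgr_lt _ cvga _ x0.
  by exists N => //=; rewrite in_itv/= xb ltW.
have L : (\int[mu]_(x in `[a k, b]) (x `^ q)%:E)%E @[k --> \oo] -->
    (b `^ (q + 1) / (q + 1))%:E.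
  under eq_fun do rewrite integral_powR_itvcc//.
  apply: cvg_EFin; first exact: nearW.
  suff : (b `^ (q + 1) - a k `^ (q + 1)) / (q + 1) @[k --> \oo] -->
      (b `^ (q + 1) - 0) / (q + 1) by rewrite subr0.
  by apply: cvgMl; apply: cvgB => //; exact: cvg_cst.
rewrite -(cvg_lim _ L)//; apply/esym/cvg_lim => //.
apply: ge0_nondecreasing_set_cvg_integral => //.
- move=> m n mn; rewrite subsetEset => x /=; rewrite !in_itv/= => /andP[h ->].
  by rewrite andbT (le_trans _ h)// ler_pM2l// lef_pV2 ?posrE// ler_nat.
- move=> k; apply/measurable_EFinP; apply: measurable_funTS.
  exact: measurable_powR.
- by move=> k x _; rewrite lee_fin powR_ge0.
Qed.

End power_integrals.

(** * Inclusions between boxes and balls, and scaling of boxes *)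

Section boxes_and_balls.
Context {R : realType} {d : nat}.

Lemma eucl_norm_coord (x : d.-tuple R) i : `|tnth x i| <= eucl_norm x.
Proof.
rewrite -sqrtr_sqr; apply: ler_wsqrtr.
by rewrite (bigD1 i)//= lerDl sumr_ge0// => j _; exact: sqr_ge0.
Qed.

(** A crude radius suffices, as a constant factor only shifts the logarithm: the squared norm is at
    most [d n^2], hence at most [(d n)^2]. *)
Lemma tbox_sub_ball n (x : d.-tuple R) : tbox n x -> eucl_norm x <= d%:R * n%:R.
Proof.
move=> xn; rewrite -[leRHS]ger0_norm ?mulr_ge0// -sqrtr_sqr; apply: ler_wsqrtr.
have h i : tnth x i ^+ 2 <= n%:R ^+ 2.
  have /andP[x1 x2] := xn i; have n0 : 0 <= n%:R :> R by [].
  rewrite -(real_normK (num_real (tnth x i))) ler_pXn2r ?nnegrE//.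
  by rewrite ler_norml; apply/andP; split; lra.
apply: (@le_trans _ _ (\sum_(i < d) n%:R ^+ 2)); first exact: ler_sum.
rewrite sumr_const card_ord exprMn -[leLHS]mulr_natl ler_wpM2r ?sqr_ge0//.
by rewrite -natrX ler_nat; case: (d) => // k; rewrite leq_pmulr.
Qed.

(** The closed ball of radius [n / 2] would meet the excluded faces of the half-open box; radius
    [n / 4] leaves room. *)
Lemma ball_sub_tbox n (x : d.-tuple R) : (0 < n)%N -> eucl_norm x <= n%:R / 4 -> tbox n x.
Proof.
move=> n0 xn i; have := le_trans (eucl_norm_coord x i) xn.
rewrite ler_norml => /andP[x1 x2]; have n1 : 0 < n%:R :> R by rewrite ltr0n.
by apply/andP; split; lra.
Qed.

Lemma nondecreasing_tbox : nondecreasing_seq (@tbox R d).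
Proof.
move=> m n; rewrite -(@ler_nat R) subsetEset => mn x xm i.
by have /andP[x1 x2] := xm i; apply/andP; split; lra.
Qed.

Lemma bigcup_tbox : \bigcup_n @tbox R d n = setT.
Proof.
apply/seteqP; split => // x _.
have [k xk] := exists_nat_ge_norm x; exists (k.*2.+1) => // i.
have := xk i; rewrite ler_norml => /andP[x1 x2].
rewrite -muln2 -natr1 natrM; apply/andP; split; lra.
Qed.

Lemma scale_tbox n : (0 < n)%N ->
  scale_tuple n%:R @^-1` (@tbox R d n) = tbox 1.
Proof.
move=> n0; have n1 : 0 < n%:R :> R by rewrite ltr0n.
suff E (x : d.-tuple R) i : (- (n%:R / 2) <= tnth (scale_tuple n%:R x) i < n%:R / 2) =
    (- (1%:R / 2) <= tnth x i < 1%:R / 2).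
  by apply/seteqP; split => x /= xn i; have := xn i; rewrite E.
rewrite tnth_mktuple (_ : n%:R / 2 = n%:R * (1%:R / 2)); last by lra.
by rewrite -mulrN ler_pM2l// ltr_pM2l.
Qed.

End boxes_and_balls.

(** * The tail of the mark distribution *)

Section tail.
Context {R : realType} {dR : measure_display} {O0 : measurableType dR}.
Context {P0 : probability O0 R} (Rv : {RV P0 >-> R}).

(* The event is [t <= R] rather than [t < R] because a point at distance exactly
   [r] belongs to the ball; [ccdf_tail] makes the two agree. *)
Definition tail (t : R) : R := fine (P0 [set w | t <= Rv w]).

Lemma measurable_tail_event t : measurable [set w | t <= Rv w].
Proof.
rewrite (_ : mkset _ = Rv @^-1` `[t, +oo[).
  by rewrite -[X in measurable X]setTI; exact: (measurable_funP Rv).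
by apply/seteqP; split => w /=; rewrite in_itv/= andbT.
Qed.

Lemma tailE t : P0 [set w | t <= Rv w] = (tail t)%:E.
Proof. by rewrite fineK// fin_num_measure//; exact: measurable_tail_event. Qed.

Lemma tail_ge0 t : 0 <= tail t.
Proof. exact: fine_ge0. Qed.

Lemma tail_le1 t : tail t <= 1.
Proof.
by rewrite -lee_fin -tailE; apply: probability_le1; exact: measurable_tail_event.
Qed.

Lemma measurable_tail : measurable_fun setT tail.
Proof.
apply: nonincreasing_measurable => // t u tu.
rewrite -lee_fin -!tailE; apply: le_measure; rewrite ?inE;
  [exact: measurable_tail_event|exact: measurable_tail_event|].
by move=> w /=; exact: le_trans.
Qed.

Lemma distribution_tail t : distribution P0 Rv [set r | t <= r] = (tail t)%:E.
Proof. exact: tailE. Qed.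

(** A single point is Lebesgue-null, so absolute continuity makes the event [Rv w = t] null. *)
Lemma ccdf_tail t : distribution P0 Rv `<< lebesgue_measure ->
  P0 [set w | t < Rv w] = (tail t)%:E.
Proof.
move=> hac; rewrite -tailE.
have P0t : P0 (Rv @^-1` [set t]) = 0.
  have /null_content_dominatesP := hac.
  by apply; [exact: measurable_set1|exact: lebesgue_measure_set1].
rewrite (_ : [set w | t <= Rv w] = [set w | t < Rv w] `|` Rv @^-1` [set t]).
  rewrite measureU//.
  - exact/esym/(etrans (congr1 (adde _) P0t))/adde0.
  - rewrite (_ : mkset _ = Rv @^-1` `]t, +oo[).
      by rewrite -[X in measurable X]setTI; exact: (measurable_funP Rv).
    by apply/seteqP; split => w /=; rewrite in_itv/= andbT.
  - by apply/seteqP; split => w //= -[+ wt]; rewrite wt ltxx.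
apply/seteqP; split => w /=; first by rewrite le_eqVlt => /predU1P[->|]; [right|left].
by case=> [/ltW|->].
Qed.

End tail.

(** * The box integral, and its limit as a moment of [R] *)

Section box_integral.
Context {R : realType} {d : nat} {dR : measure_display} {O0 : measurableType dR}.
Variables (lam : {measure set (d.-tuple R) -> \bar R}) (hlam : is_lebesgue_d lam).
Hypothesis d0 : (0 < d)%N.
Context {P0 : probability O0 R} (Rv : {RV P0 >-> R}).
Hypothesis Rv0 : forall w, 0 <= Rv w.
Variables (alpha : R) (alpha0 : 0 < alpha).

Local Notation mu := (@lebesgue_measure R).
Local Notation pos := (`]0%R, +oo[%classic : set R).

Definition tail_moment (t : R) : R := t `^ alpha * tail Rv t.

Lemma tail_moment_ge0 t : 0 <= tail_moment t.
Proof. by rewrite mulr_ge0 ?powR_ge0 ?tail_ge0. Qed.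

Lemma measurable_tail_moment : measurable_fun setT tail_moment.
Proof. by apply: measurable_funM => //; exact: measurable_tail. Qed.

Definition box_integral n : \bar R :=
  (\int[lam]_(x in tbox n) (tail_moment (eucl_norm x))%:E)%E.

Let measurable_tail_moment_norm :
  measurable_fun setT (fun x : d.-tuple R => (tail_moment (eucl_norm x))%:E).
Proof.
apply/measurable_EFinP; apply: (measurableT_comp measurable_tail_moment).
exact: measurable_eucl_norm.
Qed.

Let dR0 : 0 < d%:R :> R. Proof. by rewrite ltr0n. Qed.

Lemma powR_rootX (t : R) (q : R) : (t `^ d%:R^-1) `^ q = t `^ (q / d%:R).
Proof. by rewrite -powRrM mulrC. Qed.

Lemma root_le_powX (t x : R) : 0 <= t -> 0 <= x ->
  (t `^ d%:R^-1 <= x) = (t <= x `^ d%:R).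
Proof.
move=> t0 x0; have tE : (t `^ d%:R^-1) `^ d%:R = t.
  by rewrite powR_rootX divff ?gt_eqF// powRr1.
apply/idP/idP => h.
  by rewrite -tE ge0_ler_powR// ?nnegrE ?powR_ge0// ltW.
have := @ge0_ler_powR R d%:R^-1; rewrite invr_ge0 ler0n => /(_ isT).
move=> /(_ t (x `^ d%:R)); rewrite !nnegrE t0 powR_ge0 => /(_ isT isT h).
by rewrite -powRrM divff ?gt_eqF// powRr1.
Qed.

(** The radial formula for [g] cut off beyond [r]; the constraint [t^(1/d) <= r] turns into
    [t <= r^d]. *)
Lemma integral_ball_radial (g : R -> R) (r : R) : 0 <= r ->
  measurable_fun setT g -> (forall t, 0 <= g t) ->
  (\int[lam]_(x in [set x | (eucl_norm x <= r)%R]) (g (eucl_norm x))%:E =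
   kappa lam *
   \int[mu]_(t in `]0%R, (r `^ d%:R)%R]) (g (t `^ d%:R^-1))%:E)%E.
Proof.
move=> r0 mg g0.
pose h (t : R) : \bar R := (g t * \1_(`]-oo, r]) t)%:E.
have h0 t : (0 <= h t)%E by rewrite lee_fin mulr_ge0.
have mh : measurable_fun setT h.
  by apply/measurable_EFinP; exact: measurable_funM.
transitivity (\int[lam]_x h (eucl_norm x))%E.
  rewrite integral_mkcond; apply: eq_integral => x _; rewrite patchE /h indicE.
  case: ifPn; first by rewrite inE/= => xr; rewrite mem_set ?mulr1//= in_itv.
  by rewrite notin_setE/= => xr; rewrite memNset ?mulr0//= in_itv.
rewrite ge0_integral_radial//; congr (_ * _)%E.
rewrite [LHS]integral_mkcond [RHS]integral_mkcond; apply: eq_integral => t _.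
rewrite !patchE /h indicE; have [t0|t0] := ltP 0 (t : R); last first.
  by rewrite !memNset//= in_itv/= ltNge t0.
rewrite [t \in pos]mem_set/= ?in_itv/= ?t0//.
have -> : (t `^ d%:R^-1 \in `]-oo, r]%classic) = (t <= r `^ d%:R).
  by rewrite -root_le_powX ?(ltW t0)//; apply/idP/idP; rewrite inE/= in_itv.
case: ifPn; first by rewrite inE/= in_itv/= t0/= => ->; rewrite mulr1.
by rewrite notin_setE/= in_itv/= t0/= => /negP/negbTE ->; rewrite mulr0.
Qed.

(** The tail is the integral over [w] of the indicator of [t^(1/d) <= Rv w]. After Tonelli, the
    inner integral of [t^(alpha/d)] over []0, (Rv w)^d]] yields the power [alpha + d] of [Rv w]. *)
Lemma integral_tail_moment_radial :
  (\int[lam]_x (tail_moment (eucl_norm x))%:E =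
   kappa lam * \int[P0]_w
     (d%:R / (alpha + d%:R) * Rv w `^ (alpha + d%:R))%:E)%E.
Proof.
rewrite (ge0_integral_radial _ _ _ (fun t => (tail_moment t)%:E))//; last 2 first.
- by apply/measurable_EFinP; exact: measurable_tail_moment.
- by move=> t; rewrite lee_fin tail_moment_ge0.
congr (_ * _)%E.
(* Both constraints on [t] are put into the integrand, so that Tonelli is applied over the whole
   product space. *)
pose f (p : measurableTypeR R * O0) : \bar R :=
  (p.1 `^ (alpha / d%:R) * (\1_pos p.1 * (p.1 `^ d%:R^-1 <= Rv p.2)%R%:R))%:E.
have f0 p : (0 <= f p)%E by rewrite lee_fin mulr_ge0 ?powR_ge0// mulr_ge0.
have mp q : measurable_fun setT ((fun t => t `^ q) : measurableTypeR R -> R).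
  exact: measurable_powR.
have mf : measurable_fun setT f.
  apply/measurable_EFinP; apply: measurable_funM.
    exact: measurableT_comp (mp _) measurable_fst.
  apply: measurable_funM.
    have m1 : measurable_fun setT (\1_pos : measurableTypeR R -> R).
      by apply: measurable_indic; exact: measurable_itv.
    exact: measurableT_comp m1 measurable_fst.
  rewrite (_ : (fun p => _) = fun p => if p.1 `^ d%:R^-1 <= Rv p.2 then 1 else 0).
    apply: measurable_fun_ifT => //; apply: measurable_fun_ler.
      exact: measurableT_comp (mp _) measurable_fst.
    exact: measurableT_comp measurable_snd.
  by apply/funext => p; case: ifPn.
transitivity (\int[mu]_t \int[P0]_w f (t, w))%E.
  rewrite integral_mkcond; apply: eq_integral => t _.
  rewrite patchE; case: ifPn => [|tpos]; last first.
    by rewrite integral0_eq// => w _; rewrite /f/= indicE (negbTE tpos) mul0r mulr0.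
  move=> /[dup] tpos /[!inE]/=; rewrite in_itv/= andbT => t0.
  rewrite /f /tail_moment /= powR_rootX EFinM -tailE.
  pose A := [set w | t `^ d%:R^-1 <= Rv w].
  have mA : measurable A by exact: measurable_tail_event.
  have cA w : (t `^ d%:R^-1 <= Rv w)%R%:R = \1_A w :> R.
    by rewrite indicE; congr ((nat_of_bool _)%:R); apply/idP/idP; rewrite inE.
  under eq_integral do rewrite indicE tpos mul1r EFinM cA.
  rewrite ge0_integralZl//=; last 2 first.
  - by apply/measurable_EFinP; exact: measurable_indic.
  - by rewrite lee_fin powR_ge0.
  by congr (_ * _)%E; rewrite integral_indic// setIT.
rewrite (fubini_tonelli f)//.
apply: eq_integral => w _.
transitivity (\int[mu]_(t in `]0%R, (Rv w `^ d%:R)%R]) (t `^ (alpha / d%:R))%:E)%E.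
  rewrite [RHS]integral_mkcond; apply: eq_integral => t _.
  rewrite /f/= patchE indicE; have [t0|t0] := ltP 0 (t : R).
    rewrite [t \in pos]mem_set/= ?in_itv/= ?t0//.
    rewrite root_le_powX ?(ltW t0)// mul1r; case: ifPn.
      by rewrite inE/= in_itv/= t0/= => ->; rewrite mulr1.
    by rewrite notin_setE/= in_itv/= t0/= => /negP/negbTE ->; rewrite mulr0.
  by rewrite !memNset ?mul0r ?mulr0//= in_itv/= ltNge t0.
have q0 : 0 < alpha / d%:R by rewrite divr_gt0.
rewrite integral_powR_itv0c ?powR_ge0//; last by lra.
congr EFin.
rewrite -powRrM (_ : d%:R * (alpha / d%:R + 1) = alpha + d%:R); last first.
  by field; rewrite gt_eqF.
have : alpha + d%:R != 0 by rewrite gt_eqF// addr_gt0.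
by move=> h; field; rewrite h gt_eqF.
Qed.

Lemma cvg_box_integral_moment :
  box_integral n @[n --> \oo] -->
  ((d%:R / (alpha + d%:R))%:E * kappa lam *
    \int[P0]_w (Rv w `^ (alpha + d%:R))%:E)%E.
Proof.
have -> : ((d%:R / (alpha + d%:R))%:E * kappa lam *
    \int[P0]_w (Rv w `^ (alpha + d%:R))%:E =
   \int[lam]_(x in \bigcup_n tbox n) (tail_moment (eucl_norm x))%:E)%E.
  rewrite bigcup_tbox integral_tail_moment_radial.
  under [in RHS]eq_integral do rewrite EFinM.
  rewrite ge0_integralZl//=.
  - by rewrite [RHS]muleA (muleC (kappa lam)).
  - apply/measurable_EFinP.
    by apply: (@measurableT_comp _ _ _ _ _ _ (@powR R ^~ (alpha + d%:R)) _ Rv).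
  - by move=> w _; rewrite lee_fin powR_ge0.
  - by rewrite lee_fin divr_ge0// addr_ge0// ltW.
apply: ge0_nondecreasing_set_cvg_integral.
- exact: nondecreasing_tbox.
- by move=> n; exact: measurable_tbox.
- by move=> n; apply: measurable_funTS.
- by move=> n x _; rewrite lee_fin tail_moment_ge0.
Qed.

End box_integral.

(** * Heavy tails: dominated convergence on the unit box *)

Section heavy_tail.
Context {R : realType} {d : nat} {dR : measure_display} {O0 : measurableType dR}.
Variables (lam : {measure set (d.-tuple R) -> \bar R}) (hlam : is_lebesgue_d lam).
Hypothesis d0 : (0 < d)%N.
Context {P0 : probability O0 R} (Rv : {RV P0 >-> R}).
Variables (alpha : R) (alpha0 : 0 < alpha).
Variables (beta s : R) (beta0 : 0 < beta) (s0 : 0 < s).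
Hypothesis htail : h `^ s * tail Rv h @[h --> +oo] --> beta.

Lemma tail_bounded : exists2 C : R, 0 <= C & forall h, 0 < h -> h `^ s * tail Rv h <= C.
Proof.
have [H [_ HP]] := cvgr_le _ htail (beta + 1) (ltr_pwDr ltr01 (lexx beta)).
(* Beyond [H] the limit gives the bound [beta + 1]; up to [H] the tail is at most 1 and [h^s] at
   most [|H|^s]. *)
exists (beta + 1 + `|H| `^ s); first by rewrite !addr_ge0 ?powR_ge0// ltW.
move=> h h0; have [hH|Hh] := leP h H.
  apply: (@le_trans _ _ (`|H| `^ s)); last by rewrite lerDr addr_ge0// ltW.
  rewrite -[leRHS]mulr1 ler_pM ?powR_ge0 ?tail_ge0 ?tail_le1//.
  by apply: ge0_ler_powR; rewrite ?nnegrE ?(ltW s0) ?(ltW h0)//; exact: le_trans hH (ler_norm _).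
by apply: (le_trans (HP _ Hh)); rewrite lerDl powR_ge0.
Qed.

Let dR0 : 0 < d%:R :> R. Proof. by rewrite ltr0n. Qed.

Lemma measurable_powR_norm q :
  measurable_fun setT (fun x : d.-tuple R => eucl_norm x `^ q).
Proof.
apply: (@measurableT_comp _ _ _ _ _ _ (@powR R ^~ q)) => //.
exact: measurable_eucl_norm.
Qed.

(** The box lies in the ball of radius [d]; in the variable [t = |x|^d] the exponent is
    [q / d > -1], which is integrable at 0. *)
Lemma integral_powR_tbox1_lty q : - d%:R < q ->
  (\int[lam]_(x in tbox 1) (eucl_norm x `^ q)%:E < +oo)%E.
Proof.
move=> qd.
have mq : measurable_fun setT (fun x : d.-tuple R => (eucl_norm x `^ q)%:E).
  by apply/measurable_EFinP; exact: measurable_powR_norm.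
apply: (@le_lt_trans _ _ (\int[lam]_(x in [set x | (eucl_norm x <= d%:R)%R])
    (eucl_norm x `^ q)%:E)%E).
  apply: ge0_subset_integral => //.
  - exact: measurable_tbox.
  - exact: measurable_ball_eucl.
  - exact: measurable_funTS.
  - by move=> x _; rewrite lee_fin powR_ge0.
  - by move=> x /tbox_sub_ball; rewrite mulr1.
rewrite (integral_ball_radial _ hlam d0 (@powR R ^~ q))//; last first.
  by move=> t; exact: powR_ge0.
under eq_integral do rewrite powR_rootX.
rewrite integral_powR_itv0c ?powR_ge0//; last by rewrite ltr_pdivlMr// mulN1r.
by rewrite kappaE// -EFinM ltry.
Qed.

Let f n (x : d.-tuple R) : \bar R :=
  (n%:R `^ s * eucl_norm x `^ alpha * tail Rv (n%:R * eucl_norm x))%:E.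

(** This form isolates the factor [h^s P(R >= h)] at [h = n |x|], which tends to [beta] and is
    bounded by [tail_bounded]. *)
Let fE n x : (0 < n)%N -> 0 < eucl_norm x ->
  f n x = (eucl_norm x `^ (alpha - s) *
     ((n%:R * eucl_norm x) `^ s * tail Rv (n%:R * eucl_norm x)))%:E.
Proof.
move=> n0 x0; rewrite /f powRM ?ler0n ?ltW//.
rewrite powRD; last by rewrite (gt_eqF x0) implybT.
congr EFin; rewrite powRN; field.
by rewrite gt_eqF// powR_gt0.
Qed.

Let measurable_f n : measurable_fun setT (f n).
Proof.
apply/measurable_EFinP; apply: measurable_funM.
  by apply: measurable_funM => //; exact: measurable_powR_norm.
apply: (measurableT_comp (measurable_tail Rv)); apply: measurable_funM => //.
exact: measurable_eucl_norm.
Qed.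

(** The powers of [n] add up to [s]: [s - alpha - d] from the normalisation, [d] from the Jacobian
    and [alpha] from [|n x|^alpha]. *)
Lemma box_integral_scale n : (0 < n)%N ->
  ((n%:R `^ (s - alpha - d%:R))%:E * box_integral lam Rv alpha n =
   \int[lam]_(x in tbox 1) f n x)%E.
Proof.
move=> n0; have n1 : 0 < n%:R :> R by rewrite ltr0n.
rewrite /box_integral (ge0_integral_scale _ hlam n%:R)//; last 3 first.
- exact: measurable_tbox.
- apply/measurable_EFinP; apply: (measurableT_comp (measurable_tail_moment _ _)).
  exact: measurable_eucl_norm.
- by move=> x; rewrite lee_fin tail_moment_ge0.
rewrite scale_tbox// muleA -EFinM -powR_mulrn// -powRD ?subrK; last first.
  by rewrite (gt_eqF n1) implybT.
rewrite -ge0_integralZl//=; last 3 first.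
- exact: measurable_tbox.
- apply: measurable_funTS.
  apply/measurable_EFinP; apply: (measurableT_comp (measurable_tail_moment _ _)).
  apply: (measurableT_comp measurable_eucl_norm); exact: measurable_scale_tuple.
- by move=> x _; rewrite lee_fin tail_moment_ge0.
apply: eq_integral => x _; rewrite /f -EFinM; congr EFin.
rewrite eucl_norm_scale ?ltW// /tail_moment powRM ?eucl_norm_ge0 ?ler0n//.
rewrite powRD ?powRN; last by rewrite (gt_eqF n1) implybT.
by field; rewrite gt_eqF// powR_gt0.
Qed.

Lemma cvg_box_integral_scale : s < alpha + d%:R ->
  (\int[lam]_(x in tbox 1) f n x)%E @[n --> \oo] -->
    (beta%:E * \int[lam]_(x in tbox 1) (eucl_norm x `^ (alpha - s))%:E)%E.
Proof.
move=> sad; have [C C0 CP] := tail_bounded.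
have mp : measurable_fun setT (fun x : d.-tuple R => (eucl_norm x `^ (alpha - s))%:E).
  by apply/measurable_EFinP; exact: measurable_powR_norm.
have p0 (x : d.-tuple R) : (0 <= (eucl_norm x `^ (alpha - s))%:E)%E.
  by rewrite lee_fin powR_ge0.
rewrite -ge0_integralZl//=; last 3 first.
- exact: measurable_tbox.
- exact: measurable_funTS.
- by rewrite lee_fin ltW.
have pC0 (c : R) (x : d.-tuple R) : 0 <= c ->
    (0 <= c%:E * (eucl_norm x `^ (alpha - s))%:E)%E.
  by move=> c0; rewrite mule_ge0.
have [| | | | |_ _] := @dominated_convergence _ _ _ lam (tbox 1) (measurable_tbox 1) f
  (fun x => beta%:E * (eucl_norm x `^ (alpha - s))%:E)%E
  (fun x => C%:E * (eucl_norm x `^ (alpha - s))%:E)%E; last by apply.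
- by move=> n; exact: measurable_funTS.
- by apply: measurable_funTS; exact: measurable_funeM.
(* Pointwise convergence is shown off the origin, where [n |x|] tends to infinity. *)
- exists [set origin]; split.
  + rewrite (_ : [set _] = [set x | eucl_norm x <= 0]).
      exact: measurable_ball_eucl.
    by apply/seteqP; split => x /=; rewrite eucl_norm_eq0 => /eqP.
  + exact: lebesgue_d_origin.
  move=> x /= nx; apply: contrapT => xo; apply: nx => _.
  have x0 : 0 < eucl_norm x by rewrite ltNge eucl_norm_eq0; exact/eqP.
  have nx : n%:R * eucl_norm x @[n --> \oo] --> +oo%R.
    have cN : (r * eucl_norm x) @[r --> +oo] --> +oo%R by exact: gt0_cvgMly x0 cvg_id.
    exact: cvg_comp (@cvgr_idn R) cN.
  pose g n := eucl_norm x `^ (alpha - s) * ((n%:R * eucl_norm x) `^ s *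
    tail Rv (n%:R * eucl_norm x)).
  have h : g n @[n --> \oo] --> eucl_norm x `^ (alpha - s) * beta.
    by apply: cvgMr; exact: cvg_comp nx htail.
  rewrite -EFinM mulrC; apply: (@cvg_trans _ ((g n)%:E @[n --> \oo])).
    by apply: near_eq_cvg; exists 1%N => // n /= n0; rewrite fE.
  by apply: cvg_EFin; [exact: nearW|exact: h].
- apply: (integrableZl (measurable_tbox 1)) => //.
  apply/integrableP; split; first exact: measurable_funTS.
  under eq_integral do rewrite gee0_abs//.
  apply: integral_powR_tbox1_lty; lra.
- apply: aeW => x n _.
  rewrite gee0_abs; last first.
    by rewrite lee_fin mulr_ge0 ?tail_ge0// mulr_ge0 ?powR_ge0.
  (* Domination is needed for [n = 0] and at the origin too, where [fE] does not apply; there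
     [f n x] is 0, as 0 to a positive power is 0. *)
  have [->|n0] := posnP n; first by rewrite /f powR0 ?gt_eqF// !mul0r pC0.
  have [x0|x0] := ltP 0 (eucl_norm x).
    by rewrite fE// -EFinM lee_fin mulrC ler_wpM2r ?powR_ge0// CP// mulr_gt0// ltr0n.
  have -> : f n x = 0%E.
    have x00 : eucl_norm x = 0 by apply/eqP; rewrite eq_le x0 eucl_norm_ge0.
    by rewrite /f x00 [0 `^ alpha]powR0 ?gt_eqF// mulr0 mul0r.
  exact: pC0.
Qed.

End heavy_tail.

(** * A criterion for logarithmic growth *)

Section logarithmic_growth.
Context {R : realType}.

Lemma near_ge_natr (K : R) : \forall n \near \oo, K <= n%:R.
Proof.
exists (Num.truncn `|K|).+1 => // n /= Kn.
apply: (le_trans (ler_norm _)); apply: (le_trans (ltW (truncnS_gt _))).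
by rewrite ler_nat.
Qed.

Lemma near_ge_ln (K : R) : \forall n \near \oo, K <= ln n%:R.
Proof.
apply: filterS (near_ge_natr (expR K)) => n Kn.
by rewrite -[K]expRK ler_ln ?posrE ?expR_gt0// (lt_le_trans _ Kn)// expR_gt0.
Qed.

(** The constant [A] may depend on [eps]: it is absorbed by a further half of the tolerance once
    [ln n] is large. *)
Lemma cvg_div_ln (e : nat -> R) (B : R) :
  (forall eps, 0 < eps -> exists A, \forall n \near \oo,
     `|e n - B * ln n%:R| <= A + eps * ln n%:R) ->
  (ln n%:R)^-1 * e n @[n --> \oo] --> B.
Proof.
move=> eB; apply/cvgrPdist_le => eps eps0.
have e20 : 0 < eps / 2 by rewrite divr_gt0.
have [A eA] := eB _ e20.
near=> n.
have L0 : 0 < ln n%:R :> R.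
  by apply: (@lt_le_trans _ _ 1) => //; near: n; exact: near_ge_ln.
have LA : A <= eps / 2 * ln n%:R.
  by rewrite mulrC -ler_pdivrMr//; near: n; exact: near_ge_ln.
have H : `|e n - B * ln n%:R| <= A + eps / 2 * ln n%:R by near: n.
rewrite (_ : B - _ = - ((ln n%:R)^-1 * (e n - B * ln n%:R))); last first.
  by field; rewrite gt_eqF.
rewrite normrN normrM gtr0_norm ?invr_gt0// mulrC ler_pdivrMr//.
by apply: le_trans H _; lra.
Unshelve. all: by end_near. Qed.

End logarithmic_growth.

(** * The critical exponent [s = alpha + d] *)

Section critical_tail.
Context {R : realType} {d : nat} {dR : measure_display} {O0 : measurableType dR}.
Variables (lam : {measure set (d.-tuple R) -> \bar R}) (hlam : is_lebesgue_d lam).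
Hypothesis d0 : (0 < d)%N.
Context {P0 : probability O0 R} (Rv : {RV P0 >-> R}).
Variables (alpha : R) (alpha0 : 0 < alpha).
Variables (beta : R) (beta0 : 0 < beta).
Hypothesis htail : h `^ (alpha + d%:R) * tail Rv h @[h --> +oo] --> beta.

Local Notation mu := (@lebesgue_measure R).

Let dR0 : 0 < d%:R :> R. Proof. by rewrite ltr0n. Qed.

(** The integrand in the variable [t = |x|^d]. *)
Let phi (t : R) : R := tail_moment Rv alpha (t `^ d%:R^-1).

Let phi_ge0 t : 0 <= phi t. Proof. exact: tail_moment_ge0. Qed.

Let measurable_phi : measurable_fun setT phi.
Proof.
apply: (measurableT_comp (measurable_tail_moment _ _)).
exact: measurable_powR.
Qed.

Let mphi (D : set R) : measurable_fun D (EFin \o phi).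
Proof. by apply/measurable_EFinP; exact: measurable_funTS. Qed.

Let Phi (x : R) : \bar R := (\int[mu]_(t in `]0%R, x]) (phi t)%:E)%E.

Let phi_le t : phi t <= t `^ (alpha / d%:R).
Proof.
by rewrite /phi /tail_moment powR_rootX ler_piMr ?powR_ge0 ?tail_le1.
Qed.

(** At [h = t^(1/d)] one has [h^(alpha + d) = h^alpha t], so the hypothesis on the tail reads
    [phi t ~ beta / t]. *)
Let phiM t : 0 < t ->
  phi t = ((t `^ d%:R^-1) `^ (alpha + d%:R) * tail Rv (t `^ d%:R^-1)) * t `^ (-1).
Proof.
move=> t0; rewrite /phi /tail_moment powRD; last first.
  by rewrite [X in _ ==> ~~ X]gt_eqF ?implybT// powR_gt0.
rewrite powR_inv1 ?(ltW t0)// (powR_rootX t d%:R) divff ?gt_eqF// powRr1 ?ltW//.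
by field; rewrite gt_eqF.
Qed.

Let phi_asymp eps : 0 < eps -> exists2 T : R, 1 <= T &
  forall t, T <= t -> (beta - eps) * t `^ (-1) <= phi t <= (beta + eps) * t `^ (-1).
Proof.
move=> eps0; have /cvgrPdist_le/(_ _ eps0)[H [_ HP]] := htail.
(* [h1] exceeds [H] and is at least 1, so that the threshold [h1^d] is at least 1 as well. *)
pose h1 : R := `|H| + 1; have h11 : 1 <= h1 by rewrite lerDr.
have h10 : 0 <= h1 by apply: le_trans h11.
exists (h1 `^ d%:R); first by apply: (le_trans h11); rewrite le1r_powR// ler1n.
move=> t Tt; have t0 : 0 < t by apply: lt_le_trans Tt; rewrite powR_gt0// (lt_le_trans _ h11).
have ht : h1 <= t `^ d%:R^-1.
  have -> : h1 = (h1 `^ d%:R) `^ d%:R^-1 by rewrite -powRrM divff ?gt_eqF// powRr1.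
  by apply: ge0_ler_powR; rewrite ?nnegrE ?powR_ge0 ?invr_ge0 ?(ltW t0).
have Hh : H < t `^ d%:R^-1.
  by apply: lt_le_trans ht; rewrite (le_lt_trans (ler_norm _))// ltrDl.
have := HP _ Hh; rewrite ler_distl => /andP[lb ub].
by rewrite phiM// !ler_wpM2r ?powR_ge0//; lra.
Qed.

Let integral_scale_inv (c a b : R) : 0 <= c -> 0 < a -> a < b ->
  (\int[mu]_(t in `[a, b]) (c * t `^ (-1))%:E = (c * (ln b - ln a))%:E)%E.
Proof.
move=> c0 a0 ab; under eq_integral do rewrite EFinM.
rewrite ge0_integralZl//=.
- by rewrite integral_powRN1.
- by apply/measurable_EFinP; apply: measurable_funTS; exact: measurable_powR.
- by move=> t _; rewrite lee_fin powR_ge0.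
Qed.

(** Above [T] the integrand is compared with [(beta - eps) / t] and [(beta + eps) / t];
    [eps <= beta] keeps the lower one nonnegative, as the comparison of integrals requires. The part
    below [T] is dropped in the lower bound. *)
Lemma Phi_bounds eps : 0 < eps <= beta -> exists T C : R,
  forall x, T < x ->
    (((beta - eps) * (ln x - ln T))%:E <= Phi x)%E /\
    (Phi x <= (C + (beta + eps) * (ln x - ln T))%:E)%E.
Proof.
move=> /andP[eps0 epsb]; have [T T1 TP] := phi_asymp _ eps0.
have T0 : 0 < T by apply: lt_le_trans T1.
(* [C] is the integral over []0, T]] of [t^(alpha/d)], which bounds [phi] because the tail is at
   most 1. *)
exists T, (T `^ (alpha / d%:R + 1) / (alpha / d%:R + 1)) => x Tx.
have minv c (D : set R) : measurable_fun D (fun t : R => (c * t `^ (-1))%:E).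
  apply/measurable_EFinP; apply: measurable_funTS; apply: measurable_funM => //.
split.
  rewrite -integral_scale_inv ?subr_ge0//.
  apply: (@le_trans _ _ (\int[mu]_(t in `[T, x]) (phi t)%:E)%E).
    apply: ge0_le_integral => //.
    - by move=> t _; rewrite lee_fin mulr_ge0 ?subr_ge0 ?powR_ge0.
    - exact: minv.
    - exact: mphi.
    - by move=> t; rewrite /= in_itv/= => /andP[Tt _]; rewrite lee_fin; have /andP[] := TP _ Tt.
  apply: ge0_subset_integral => //; [exact: mphi|by move=> t _; rewrite lee_fin|].
  move=> t; rewrite /= !in_itv/= => /andP[Tt tx].
  by apply/andP; split => //; exact: lt_le_trans Tt.
have -> : Phi x = (\int[mu]_(t in `]0%R, T]) (phi t)%:E +
                   \int[mu]_(t in `]T, x]) (phi t)%:E)%E.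
  rewrite /Phi -ge0_integral_setU//; last 3 first.
  - exact: mphi.
  - by move=> t _; rewrite lee_fin.
  - apply/disj_setPS => t [] /=; rewrite !in_itv/= => /andP[_ tT] /andP[Tt _].
    by have := le_lt_trans tT Tt; rewrite ltxx.
  congr (integral _ _ _); apply/seteqP; split => t /=; rewrite !in_itv/=.
    by move=> /andP[-> ->]; rewrite andbT; case: (leP (t : R) T) => ?; [left|right].
  case=> /andP[h1 h2]; apply/andP; split => //.
    by rewrite (le_trans h2)// ltW.
  exact: lt_trans h1.
rewrite EFinD; apply: leeD.
  have q0 : 0 < alpha / d%:R by rewrite divr_gt0.
  rewrite -integral_powR_itv0c ?(ltW T0)//; last by lra.
  apply: ge0_le_integral => //.
  - by move=> t _; rewrite lee_fin.
  - exact: mphi.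
  - by apply/measurable_EFinP; apply: measurable_funTS; exact: measurable_powR.
  - by move=> t _; rewrite lee_fin phi_le.
rewrite -integral_scale_inv ?addr_ge0 ?(ltW eps0) ?(ltW beta0)//.
apply: (@le_trans _ _ (\int[mu]_(t in `[T, x]) (phi t)%:E)%E).
  apply: ge0_subset_integral => //; [exact: mphi|by move=> t _; rewrite lee_fin|].
  by move=> t; rewrite /= !in_itv/= => /andP[Tt tx]; apply/andP; split => //; exact: ltW.
apply: ge0_le_integral => //.
- by move=> t _; rewrite lee_fin.
- exact: mphi.
- exact: minv.
by move=> t; rewrite /= in_itv/= => /andP[Tt _]; rewrite lee_fin; have /andP[] := TP _ Tt.
Qed.

Let measurable_tail_moment_norm (D : set (d.-tuple R)) :
  measurable_fun D (fun x => (tail_moment Rv alpha (eucl_norm x))%:E).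
Proof.
apply: measurable_funTS; apply/measurable_EFinP.
apply: (measurableT_comp (measurable_tail_moment _ _)).
exact: measurable_eucl_norm.
Qed.

Let ball_integral (r : R) : 0 <= r ->
  (\int[lam]_(x in [set x | (eucl_norm x <= r)%R])
     (tail_moment Rv alpha (eucl_norm x))%:E = kappa lam * Phi (r `^ d%:R))%E.
Proof.
move=> r0; rewrite (integral_ball_radial _ hlam d0 (tail_moment Rv alpha))//.
  exact: measurable_tail_moment.
by move=> t; exact: tail_moment_ge0.
Qed.

Lemma box_integral_bounds n : (0 < n)%N ->
  (kappa lam * Phi ((n%:R / 4) `^ d%:R) <= box_integral lam Rv alpha n)%E /\
  (box_integral lam Rv alpha n <= kappa lam * Phi ((d%:R * n%:R) `^ d%:R))%E.
Proof.
move=> n0; split.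
  rewrite -ball_integral ?divr_ge0//; apply: ge0_subset_integral => //.
  - exact: measurable_ball_eucl.
  - exact: measurable_tbox.
  - by move=> x _; rewrite lee_fin tail_moment_ge0.
  - by move=> x; exact: ball_sub_tbox.
rewrite -ball_integral ?mulr_ge0//; apply: ge0_subset_integral => //.
- exact: measurable_tbox.
- exact: measurable_ball_eucl.
- by move=> x _; rewrite lee_fin tail_moment_ge0.
- by move=> x; exact: tbox_sub_ball.
Qed.

Let kap := fine (kappa lam).

Let kap0 : 0 <= kap. Proof. exact: fine_ge0. Qed.

Let box_integral_ln_bounds eps : 0 < eps <= beta -> exists T C : R,
  \forall n \near \oo, box_integral lam Rv alpha n \is a fin_num /\
    kap * ((beta - eps) * (d%:R * (ln n%:R - ln 4) - ln T)) <=
      fine (box_integral lam Rv alpha n) <=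
    kap * (C + (beta + eps) * (d%:R * (ln d%:R + ln n%:R) - ln T)).
Proof.
move=> epsb; have [T [C TC]] := Phi_bounds _ epsb; exists T, C.
near=> n.
(* From [4 <= n], the power [d] does not decrease [n / 4]; from [4 (T + 1) <= n], both arguments of
   [Phi] exceed [T]. *)
have n4 : 4 <= n%:R :> R by near: n; exact: near_ge_natr.
have nT : 4 * (T + 1) <= n%:R by near: n; exact: near_ge_natr.
have n0 : (0 < n)%N by rewrite -(ltr0n R) (lt_le_trans _ n4).
have n1 : 0 < n%:R :> R by rewrite ltr0n.
have d1 : 1 <= d%:R :> R by rewrite ler1n.
have lo : T < (n%:R / 4) `^ d%:R.
  apply: (@lt_le_trans _ _ (n%:R / 4)); first by lra.
  by apply: le1r_powR => //; lra.
have up : T < (d%:R * n%:R) `^ d%:R.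
  apply: (@lt_le_trans _ _ (d%:R * n%:R)); first by nra.
  by apply: le1r_powR => //; nra.
have [lb ub] := box_integral_bounds n n0.
have [{}lo _] := TC _ lo; have [_ {}up] := TC _ up.
move: lb ub; rewrite (kappaE lam hlam)// -/kap => lb ub.
have {}lb := le_trans (lee_wpmul2l _ lo) lb.
have {}ub := le_trans ub (lee_wpmul2l _ up).
move: lb ub; rewrite -!EFinM !ln_powR ln_div ?posrE// lnM ?posrE// => lb ub.
have fin : box_integral lam Rv alpha n \is a fin_num.
  rewrite ge0_fin_numE; last by apply: integral_ge0 => x _; rewrite lee_fin tail_moment_ge0.
  by apply: le_lt_trans (ub _) _; rewrite ?lee_fin// ltry.
split => //; apply/andP; split; rewrite -lee_fin fineK//.
- by apply: lb; rewrite lee_fin.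
- by apply: ub; rewrite lee_fin.
Unshelve. all: by end_near. Qed.

Lemma cvg_box_integral_ln :
  ((ln n%:R)^-1%:E * box_integral lam Rv alpha n)%E @[n --> \oo] -->
  (d%:R%:E * kappa lam * beta%:E)%E.
Proof.
have -> : (d%:R%:E * kappa lam * beta%:E)%E = (kap * d%:R * beta)%:E.
  by rewrite (kappaE lam hlam)// -!EFinM (mulrC d%:R).
have cv : (ln n%:R)^-1 * fine (box_integral lam Rv alpha n) @[n --> \oo] -->
    kap * d%:R * beta.
  apply: cvg_div_ln => eps eps0.
  have k1 : 0 < kap * d%:R + 1 by rewrite ltr_wpDl// mulr_ge0// ltW.
  (* The first entry ensures [e <= beta] for the bounds, the second [kap * d * e <= eps]; the added
     1 keeps the denominator positive. *)
  pose e := Num.min beta (eps / (kap * d%:R + 1)).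
  have e0 : 0 < e by rewrite lt_min beta0 divr_gt0.
  have eb : e <= beta by rewrite ge_min lexx.
  have ke : kap * d%:R * e <= eps.
    apply: (@le_trans _ _ ((kap * d%:R + 1) * e)).
      by rewrite ler_wpM2r ?(ltW e0)// lerDl.
    by rewrite mulrC -ler_pdivlMr// ge_min lexx orbT.
  have [|T [C TC]] := box_integral_ln_bounds e; first by rewrite e0 eb.
  (* These are the constants left in the lower and upper bounds after removing the multiples of
     [ln n]. *)
  exists (`|kap * ((beta - e) * (d%:R * ln 4 + ln T))| +
          `|kap * (C + (beta + e) * (d%:R * ln d%:R - ln T))|).
  near=> n.
  have [_ /andP[lb ub]] : box_integral lam Rv alpha n \is a fin_num /\
    kap * ((beta - e) * (d%:R * (ln n%:R - ln 4) - ln T)) <=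
      fine (box_integral lam Rv alpha n) <=
    kap * (C + (beta + e) * (d%:R * (ln d%:R + ln n%:R) - ln T)) by near: n.
  have L0 : 0 <= ln n%:R :> R by near: n; exact: near_ge_ln.
  have keL := ler_wpM2r L0 ke.
  have h1 := ler_norm (kap * ((beta - e) * (d%:R * ln 4 + ln T))).
  have h2 := ler_norm (kap * (C + (beta + e) * (d%:R * ln d%:R - ln T))).
  have h3 := normr_ge0 (kap * ((beta - e) * (d%:R * ln 4 + ln T))).
  have h4 := normr_ge0 (kap * (C + (beta + e) * (d%:R * ln d%:R - ln T))).
  rewrite ler_norml; apply/andP; split; lra.
(* Here the bounds serve only to know that the box integral is eventually finite, which lets [fine]
   be removed. *)
have [|T [C TC]] := box_integral_ln_bounds beta; first by rewrite beta0 lexx.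
apply: (@cvg_trans _ (((ln n%:R)^-1 * fine (box_integral lam Rv alpha n))%:E @[n --> \oo])).
  by apply: near_eq_cvg; apply: filterS TC => n [fin _]; rewrite EFinM fineK.
by apply: cvg_EFin; [exact: nearW|exact: cv].
Unshelve. all: by end_near. Qed.

End critical_tail.

(** * The three regimes of the expected in-degree *)

Theorem theorem2p3 (R : realType) (d : nat) (hd : (2 <= d)%N)
  (lam : {measure set (d.-tuple R) -> \bar R}) (hlam : is_lebesgue_d lam)
  (dR : measure_display) (O0 : measurableType dR) (P0 : probability O0 R)
  (Rv : {RV P0 >-> R}) (hRnn : forall w, 0 <= Rv w)
  (hac : distribution P0 Rv `<< lebesgue_measure)
  (beta s : R) (hbeta : 0 < beta) (hs : 0 < s)
  (htail : ((h `^ s)%:E * P0 [set w | (h < Rv w)%R])%E @[h --> +oo%R] --> beta%:E)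
  (dO : nat -> measure_display) (O : forall n, measurableType (dO n))
  (P : forall n, probability (O n) R) (X : forall n, O n -> seq (d.-tuple R * R))
  (hX : forall n, (1 <= n)%N -> is_marked_ppp n lam (distribution P0 Rv) (P n) (X n))
  (alpha : R) (halpha : 0 < alpha) :
  let ED := fun n => (\int[P n]_w (D_in alpha n (X n w))%:E)%E in
  [/\ alpha + d%:R < s ->
        ED @ \oo --> ((d%:R / (alpha + d%:R))%:E * kappa lam *
                      \int[P0]_w (Rv w `^ (alpha + d%:R))%:E)%E,
      s = alpha + d%:R ->
        (fun n => ((ln n%:R)^-1)%:E * ED n)%E @ \oo --> (d%:R%:E * kappa lam * beta%:E)%E
    & s < alpha + d%:R ->
        (fun n => (n%:R `^ (s - alpha - d%:R))%:E * ED n)%E @ \oo -->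
          (beta%:E * \int[lam]_(eta in tbox 1) (tnorm 1 eta `^ (alpha - s))%:E)%E].
Proof.
move=> ED; have d0 : (0 < d)%N by exact: ltnW.
have EDE n : (0 < n)%N -> ED n = box_integral lam Rv alpha n.
  move=> n0; rewrite /ED (expected_D_in _ hlam _ _ n0 _ _ (hX n n0)).
  apply: eq_integral => x _; rewrite /tail_moment EFinM; congr (_ * _)%E.
  exact: distribution_tail.
(* The assumption concerns [P(R > h)], while the in-degree involves [P(R >= h)]; absolute continuity
   identifies them. *)
have tail_cvg : h `^ s * tail Rv h @[h --> +oo] --> beta.
  have : (h `^ s * tail Rv h)%:E @[h --> +oo] --> beta%:E.
    by apply: cvg_trans htail; under eq_fun do rewrite EFinM -(ccdf_tail Rv _ hac).
  by move/fine_cvg.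
split.
- move=> _; apply: cvg_trans (cvg_box_integral_moment lam hlam d0 Rv hRnn alpha halpha).
  by apply: near_eq_cvg; exists 1%N => // n /= n0; rewrite EDE.
- move=> sE; rewrite sE in tail_cvg.
  apply: cvg_trans (cvg_box_integral_ln lam hlam d0 Rv alpha halpha beta hbeta tail_cvg).
  by apply: near_eq_cvg; exists 1%N => // n /= n0; rewrite EDE.
- move=> sad.
  have -> : (\int[lam]_(eta in tbox 1) (tnorm 1 eta `^ (alpha - s))%:E =
      \int[lam]_(x in tbox 1) (eucl_norm x `^ (alpha - s))%:E)%E.
    by apply: eq_integral => x; rewrite inE => x1; rewrite tnorm_eucl.
  apply: cvg_trans (cvg_box_integral_scale lam hlam d0 Rv alpha halpha beta s hbeta hs
    tail_cvg sad).
  by apply: near_eq_cvg; exists 1%N => // n /= n0; rewrite EDE// box_integral_scale.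
Qed.
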